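(* Let $X$ be a quasi-Banach function space over $\mathbf{R}^d$. If $X\in A_{\mathrm{sparse}}$, then there is an $r_0>1$ such that for every $1<r\le r_0$ we have $X^r\in A_{\mathrm{sparse}}$ and \[[X^r]_{A_{\mathrm{sparse}}}^{1/r}\lesssim_{d,K_X}[X]_{A_{\mathrm{sparse}}}.\]
   Context: Cubes are axis-parallel cubes in $\mathbf{R}^d$. A quasi-Banach function space over $\mathbf{R}^d$ is a complete quasi-normed space $X\subseteq L^0(\mathbf{R}^d)$ with the ideal property (if $f\in X$, $|g|\le|f|$ then $g\in X$, $\|g\|_X\le\|f\|_X$) and the saturation property (every set of positive measure contains a subset $F$ of positive measure with $\mathbf{1}_F\in X$). $K_X\ge1$ is the optimal constant with $\|f+g\|_X\le K_X(\|f\|_X+\|g\|_X)$. For $0<p<\infty$, $X^p=\{f:|f|^{1/p}\in X\}$, $\|f\|_{X^p}=\||f|^{1/p}\|_X^p$. A collection $\mathcal{S}$ of cubes is sparse if there are pairwise disjoint $E_Q\subseteq Q$ with $|E_Q|\ge\frac12|Q|$. With $A_{\mathcal{S}}f=\sum_{Q\in\mathcal{S}}\big(\frac1{|Q|}\int_Q|f|\big)\mathbf{1}_Q$, $Y\in A_{\mathrm{sparse}}$ means there is $C$ with $\|A_{\mathcal{S}}f\|_Y\le C\|f\|_Y$ for every sparse $\mathcal{S}$ and $f\in Y$; the least $C$ is $[Y]_{A_{\mathrm{sparse}}}$. *)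

(* Defs.v *)
From HB Require Import structures.
From mathcomp Require Import all_boot all_order all_algebra.
From mathcomp Require Import all_classical all_reals all_analysis.
Set Implicit Arguments. Unset Strict Implicit. Unset Printing Implicit Defensive.
Import Order.TTheory GRing.Theory Num.Theory.
Local Open Scope classical_set_scope.
Local Open Scope ring_scope.

Section Rd.
Variable R : realType.

Record mspace := MSpace {
  ms_disp : measure_display;
  ms_car : measurableType ms_disp;
  ms_mu : {measure set ms_car -> \bar R} }.

(* R^d with Lebesgue measure, built as ((pt * R) * R) * ... * R
   with the product of one-dimensional Lebesgue measures. *)
Fixpoint Rd_space (d : nat) : mspace :=
  match d with
  | 0 => @MSpace _ unit (@dirac _ unit tt R)
  | n.+1 => let p := Rd_space n in
      @MSpace _ (ms_car p * measurableTypeR R)%type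
        ((ms_mu p) \x (@lebesgue_measure R))%E
  end.

Definition Rd (d : nat) : measurableType (ms_disp (Rd_space d)) := ms_car (Rd_space d).
Definition leb (d : nat) : {measure set Rd d -> \bar R} := ms_mu (Rd_space d).

Fixpoint coord (d : nat) : Rd d -> 'I_d -> R :=
  match d return Rd d -> 'I_d -> R with
  | 0 => fun _ _ => 0
  | n.+1 => fun x i =>
      match unlift ord_max i with
      | Some j => @coord n x.1 j
      | None => x.2
      end
  end.

Record cube (d : nat) := Cube { corner : 'I_d -> R; side : R }.
HB.instance Definition _ d := gen_eqMixin (cube d).
HB.instance Definition _ d := gen_choiceMixin (cube d).

Definition cube_set d (Q : cube d) : set (Rd d) :=
  [set x | forall i, corner Q i <= coord x i < corner Q i + side Q].

Definition is_cube d (Q : cube d) := 0 < side Q.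

Definition sparse d (S : set (cube d)) : Prop :=
  (forall Q, S Q -> is_cube Q) /\
  exists E : cube d -> set (Rd d),
    (forall Q, S Q -> measurable (E Q) /\ E Q `<=` cube_set Q /\
        ((2^-1)%:E * leb d (cube_set Q) <= leb d (E Q))%E) /\
    (forall Q Q', S Q -> S Q' -> Q <> Q' -> E Q `&` E Q' = set0).

Definition avg d (Q : cube d) (f : Rd d -> R) : \bar R :=
  ((leb d (cube_set Q))^-1 * \int[leb d]_(x in cube_set Q) (`|f x|)%:E)%E.

Definition sparse_op d (S : set (cube d)) (f : Rd d -> R) (x : Rd d) : \bar R :=
  (\esum_(Q in S) (avg Q f * (\1_(cube_set Q) x)%:E))%E.

(* A space is given by its carrier X (a set of functions, understood modulo
   a.e. equality) and its quasi-norm nX. *)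

Definition quasi_triangle d (X : set (Rd d -> R)) (nX : (Rd d -> R) -> R) (K : R) :=
  forall f g, X f -> X g -> nX (f \+ g) <= K * (nX f + nX g).

Definition optimal_const d (X : set (Rd d -> R)) (nX : (Rd d -> R) -> R) (K : R) :=
  1 <= K /\ quasi_triangle X nX K /\
  (forall K', 1 <= K' -> quasi_triangle X nX K' -> K <= K').

Definition qBFS d (X : set (Rd d -> R)) (nX : (Rd d -> R) -> R) : Prop :=
  (forall f, X f -> measurable_fun setT f) /\
  X (fun _ => 0) /\
  (forall f g, X f -> X g -> X (f \+ g)) /\
  (forall (c : R) f, X f -> X (fun x => c * f x)) /\
  (forall f, X f -> 0 <= nX f) /\
  (forall f, X f -> (nX f = 0 <-> {ae leb d, forall x, f x = 0})) /\
  (forall (c : R) f, X f -> nX (fun x => c * f x) = `|c| * nX f) /\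
  (exists K, quasi_triangle X nX K) /\
  (forall u : nat -> Rd d -> R, (forall n, X (u n)) ->
     (forall e, 0 < e -> exists N, forall m n, (N <= m)%N -> (N <= n)%N ->
        nX (u n \- u m) < e) ->
     exists2 f, X f & forall e, 0 < e -> exists N, forall n, (N <= n)%N ->
        nX (u n \- f) < e) /\
  (forall f (g : Rd d -> R), X f -> measurable_fun setT g ->
     {ae leb d, forall x, `|g x| <= `|f x|} -> X g /\ nX g <= nX f) /\
  (forall E, measurable E -> (0 < leb d E)%E ->
     exists F, [/\ measurable F, F `<=` E, (0 < leb d F)%E & X (\1_F)]).

Definition Xpow d (X : set (Rd d -> R)) (p : R) : set (Rd d -> R) :=
  [set f : Rd d -> R | measurable_fun setT f /\ X (fun x => powR `|f x| p^-1)].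

Definition nXpow d (nX : (Rd d -> R) -> R) (p : R) (f : Rd d -> R) : R :=
  powR (nX (fun x => powR `|f x| p^-1)) p.

Definition Asparse_with d (Y : set (Rd d -> R)) (nY : (Rd d -> R) -> R) (C : R) :=
  0 <= C /\
  forall S f, sparse S -> Y f ->
    {ae leb d, forall x, (sparse_op S f x < +oo)%E} /\
    Y (fun x => fine (sparse_op S f x)) /\
    nY (fun x => fine (sparse_op S f x)) <= C * nY f.

Definition Asparse d (Y : set (Rd d -> R)) (nY : (Rd d -> R) -> R) :=
  exists C, Asparse_with Y nY C.

Definition Asparse_const d (Y : set (Rd d -> R)) (nY : (Rd d -> R) -> R) : R :=
  inf [set C | Asparse_with Y nY C].

End Rd.

(* Main.v *)
Require Import Defs.
From HB Require Import structures.
From mathcomp Require Import all_boot all_order all_algebra.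
From mathcomp Require Import all_classical all_reals all_analysis.
From mathcomp Require Import measurable_realfun ring lra.
Import Order.TTheory GRing.Theory Num.Theory.
Local Open Scope classical_set_scope.
Local Open Scope ring_scope.
Set Implicit Arguments. Unset Strict Implicit. Unset Printing Implicit Defensive.

(* Every dyadic maximal function of f in X is bounded pointwise by a multiple of
   A_S f for a sparse family S of principal cubes; such cubes exist because
   averages over increasing towers of cubes are summable, towers being sparse.
   By the one-third trick, 2^d dyadic grids control all cubes, so f has a majorant
   F in X with ||F|| <= C1 ||f|| and <|f|>_Q <= F a.e. on every cube Q. Iterating
   as in Rubio de Francia's algorithm, g in X lies below some w in X with
   ||w|| <= 2 K^2 ||g|| and <w>_Q <= C w a.e. on every Q.
   Such an A_1 weight satisfies <w^r>_Q <= 8 <w>_Q^r for r = 1 + delta close to 1: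
   if M_n is the maximal average over the dyadic subcubes of Q of generation at
   most n, then refining from n to n + 1 increases the integral of w M_n^delta by
   at most 2^d delta times the increase of the integral of M_n^(1 + delta), which
   is itself at most C times the integral of w M_n^delta, and is absorbed for
   small delta.
   With g = |f|^(1/r) this gives A_S f <= 8 (A_S w)^r, so the constant of X^r to
   the power 1/r is at most 16 K^2 [X]; only r0 depends on C. *)

(* [coord] would otherwise be the one of vector.v. *)
Local Notation coord := Defs.coord.

(** * Cubes in Euclidean space *)

Section Geometry.
Variable R : realType.

(** [X] is only quasi-normed and has no Fatou property, so neither duality nor pointwise limits are
    at hand; the A_1 weight is therefore built inside [X] as a series that converges in quasi-norm.
    The maximal function over all cubes is never formed: it is replaced by a majorant in [X], with
    the inequality holding a.e. for each cube separately. The null set may depend on the cube, which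
    is harmless because each use concerns countably many cubes. The sparse hypothesis enters twice.
    First it yields the majorants; the constant [C] so obtained may depend on it in any way, because
    it only decides how close to 1 the exponent must be. Then it bounds [A_S w], and only this use,
    linear in the constant, is seen in the final estimate. Two devices keep the reverse Hoelder
    inequality elementary. Truncating the maximal function makes the integrals finite, so that
    absorbing is legitimate. The differentiation theorem is needed only up to a factor 4, and its
    power [4 ^ delta] is at most 4; together with a factor 2 from absorbing this gives the 8. *)

Lemma coord_lift d (x : Rd R d.+1) (j : 'I_d) :
  coord x (lift ord_max j) = coord x.1 j.
Proof. by rewrite /= liftK. Qed.

Lemma coord_max d (x : Rd R d.+1) : coord x ord_max = x.2.
Proof. by rewrite /= unlift_none. Qed.

Lemma cube_setS d (Q : cube R d.+1) :
  cube_set Q = cube_set (Cube (fun j => corner Q (lift ord_max j)) (side Q))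
    `*` `[corner Q ord_max, corner Q ord_max + side Q[.
Proof.
apply/seteqP; split => [x Qx|x [/= Q1 Q2] i].
- split => [j|/=]; first by have := Qx (lift ord_max j); rewrite coord_lift.
  by have := Qx ord_max; rewrite coord_max in_itv.
- case: (unliftP ord_max i) => [j|] ->; rewrite ?coord_lift ?coord_max.
    exact: Q1.
  by move: Q2; rewrite in_itv.
Qed.

Lemma measurable_cube d (Q : cube R d) : measurable (cube_set Q).
Proof.
elim: d Q => [|d IH] Q.
  rewrite (_ : cube_set Q = setT); first exact: measurableT.
  by apply/seteqP; split => // x _ [].
by rewrite cube_setS; apply: measurableX => //; exact: measurable_itv.
Qed.

Lemma leb_cube d (Q : cube R d) : is_cube Q ->
  leb R d (cube_set Q) = (side Q ^+ d)%:E.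
Proof.
elim: d Q => [|d IH] Q Q0.
  rewrite (_ : cube_set Q = setT); last by apply/seteqP; split => // x _ [].
  by rewrite /leb /= diracT.
rewrite cube_setS [LHS]product_measure1E; [|exact: measurable_cube|exact: measurable_itv].
rewrite [X in (X * _)%E](IH (Cube _ (side Q))) //.
rewrite [X in (_ * X)%E]lebesgue_measure_itv /= lte_fin ltrDl (_ : 0 < side Q) //.
by rewrite -EFinD -EFinM addrAC subrr add0r exprSr.
Qed.

Lemma leb_cube_gt0 d (Q : cube R d) : is_cube Q -> (0 < leb R d (cube_set Q))%E.
Proof. by move=> Q0; rewrite leb_cube// lte_fin exprn_gt0. Qed.

Lemma leb_cube_lty d (Q : cube R d) : is_cube Q -> (leb R d (cube_set Q) < +oo)%E.
Proof. by move=> Q0; rewrite leb_cube// ltry. Qed.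

Lemma sigma_algebra_preimage (T U : Type) (f : T -> U) (G : set_system T) :
  sigma_algebra setT G -> sigma_algebra setT [set A | G (f @^-1` A)].
Proof.
move=> [G0 GD GU]; split => /=; first by rewrite preimage_set0.
- by move=> A GA; rewrite setTD preimage_setC -setTD; exact: GD.
- by move=> A GA; rewrite preimage_bigcup; exact: GU.
Qed.

(** The product sigma-algebra is generated by preimages under the two projections, and the sets
    whose preimage lies in [G] again form a sigma-algebra, so induction on [d] applies. Properties
    of all measurable sets are thereby reduced to half-spaces. *)
Lemma measurable_sub_coord d (G : set_system (Rd R d)) : sigma_algebra setT G ->
  (forall i t, G [set x | coord x i < t]) -> measurable `<=` G.
Proof.
elim: d G => [|d IH] G sG Gi.
  have [G0 GD GU] := sG.
  move=> A _; have [At|At] := pselect (A tt).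
  - rewrite (_ : A = setT); first by rewrite -(setD0 setT); exact: GD.
    by apply/seteqP; split => // -[].
  - rewrite (_ : A = set0)//; apply/seteqP; split => // -[]//.
apply: (@smallest_sub _ (sigma_algebra setT)
  (preimage_set_system setT (@fst (Rd R d) R) measurable `|`
   preimage_set_system setT (@snd (Rd R d) (measurableTypeR R)) measurable) G) => //.
rewrite subUset; split => _ [A mA <-]; rewrite setTI.
- move: A mA; apply: (IH _ (sigma_algebra_preimage fst sG)) => i t /=.
  rewrite (_ : _ @^-1` _ = [set x | coord x (lift ord_max i) < t]) //.
  by apply/funext => x; rewrite /preimage /mkset coord_lift.
- move: A mA; have := sigma_algebra_preimage snd sG.
  set H := [set _ | _] => sH.
  have := RGenInftyO.measurableE R; rewrite /measurable /= => e A; rewrite e.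
  move: A; apply: (@smallest_sub _ (sigma_algebra setT) _ H) => // _ [x ->].
  rewrite /H /= (_ : _ @^-1` _ = [set y | coord y ord_max < x]) //.
  by apply/funext => y; rewrite /preimage /mkset coord_max /= in_itv.
Qed.

End Geometry.

(** * Dyadic grids and averages *)

Section Grids.
Variable R : realType.
Variable d : nat.
Local Notation T := (Rd R d).
Local Notation mu := (leb R d).
Implicit Types (k l : int) (x y : T) (U : set T) (f : T -> R).

(** Cells grow with [k]. The origin may change with the generation, so that the shifted grids of the
    one-third trick are instances; [goS] is what keeps the cells nested. *)
Record grid := Grid {
  gh : int -> R;
  go : int -> 'I_d -> R;
  gh_gt0 : forall k, 0 < gh k;
  ghS : forall k, gh (k + 1) = 2 * gh k;
  goS : forall k i, exists z : int, go (k + 1) i - go k i = z%:~R * gh k }.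

Variable D : grid.

Definition idx k x : {ffun 'I_d -> int} :=
  [ffun i => Num.floor ((coord x i - go D k i) / gh D k)].

Definition qcube k (m : {ffun 'I_d -> int}) : cube R d :=
  Cube (fun i => go D k i + (m i)%:~R * gh D k) (gh D k).

Definition cell k x := qcube k (idx k x).

Lemma is_cube_qcube k m : is_cube (qcube k m).
Proof. exact: gh_gt0. Qed.

Lemma in_qcube k m x : cube_set (qcube k m) x <-> idx k x = m.
Proof.
have h0 := gh_gt0 D k.
split => [mx|<- i].
- apply/ffunP => i; rewrite ffunE; apply/eqP; rewrite floor_eq.
  move: (mx i) => /= /andP[h1 h2].
  rewrite ler_pdivlMr// ltr_pdivrMr// intrD mulr1z mulrDl.
  by apply/andP; split; lra.
- rewrite /= ffunE.
  have := floor_itv ((coord x i - go D k i) / gh D k).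
  rewrite ler_pdivlMr// ltr_pdivrMr// intrD mulr1z mulrDl.
  by move=> /andP[h1 h2]; apply/andP; split; lra.
Qed.

Lemma in_cell k x y : cube_set (cell k x) y <-> idx k y = idx k x.
Proof. exact: in_qcube. Qed.

Lemma cell_self k x : cube_set (cell k x) x.
Proof. exact/in_cell. Qed.

(** Passing to the parent turns the normalized coordinate [v] into [(v - z) / 2] with [z] an
    integer, and the floor of this depends only on the floor of [v]. *)
Lemma idxS k x y : idx k x = idx k y -> idx (k + 1) x = idx (k + 1) y.
Proof.
have h0 := gh_gt0 D k.
move=> /ffunP xy; apply/ffunP => i; have := xy i; rewrite !ffunE.
have [z oz] := goS D k i.
have redx u : (u - go D (k + 1) i) / gh D (k + 1)
    = ((u - go D k i) / gh D k - z%:~R) / 2.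
  have -> : go D (k + 1) i = go D k i + z%:~R * gh D k by move: oz; lra.
  by rewrite ghS; field; rewrite gt_eqF.
rewrite !redx; set u := _ / _; set v := _ / _ => uv.
apply/eqP; rewrite floor_eq.
have := floor_itv ((v - z%:~R) / 2); set q := Num.floor _ => /andP[q1 q2].
have q1' : 2 * q + z <= Num.floor v.
  by rewrite floor_ge_int rmorphD rmorphM/=; lra.
have q2' : Num.floor v < 2 * (q + 1) + z.
  by rewrite floor_lt_int 2!rmorphD rmorphM/= in q2 *; lra.
rewrite -uv floor_ge_int in q1'; rewrite -uv floor_lt_int in q2'.
rewrite !(rmorphD, rmorphM)/= in q1' q2' q1 q2 *.
by apply/andP; split; lra.
Qed.

Lemma idx_addn k n x y : idx k x = idx k y -> idx (k + n%:Z) x = idx (k + n%:Z) y.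
Proof.
elim: n => [|n IH] e; first by rewrite addr0.
by rewrite -addn1 PoszD addrA; exact/idxS/IH.
Qed.

Lemma idx_le k l x y : k <= l -> idx k x = idx k y -> idx l x = idx l y.
Proof.
move=> kl; have -> : l = k + (`|l - k|%N)%:Z by rewrite gez0_abs ?subr_ge0// subrKC.
exact: idx_addn.
Qed.

Lemma sub_cell k l x : k <= l -> cube_set (cell k x) `<=` cube_set (cell l x).
Proof. by move=> kl y /in_cell yx; apply/in_cell/(idx_le kl). Qed.

Lemma cell_eq k x y : idx k x = idx k y -> cell k x = cell k y.
Proof. by rewrite /cell => ->. Qed.

(** These are the unions of cells of generation [k]. *)
Definition genset k U := forall x y, idx k x = idx k y -> U x -> U y.

Lemma genset_le k l U : k <= l -> genset l U -> genset k U.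
Proof. by move=> kl gU x y /(idx_le kl); exact: gU. Qed.

(** [pickle] numbers the cells, so that countable additivity applies; numbers that code no cell of
    [U] give empty parts. *)
Definition genpart k U (n : nat) : set T :=
  [set x | U x /\ pickle (idx k x) = n].

Lemma genpart_cell k U x : genset k U -> U x ->
  genpart k U (pickle (idx k x)) = cube_set (cell k x).
Proof.
move=> gU Ux; apply/seteqP; split => [y [_ /(pcan_inj pickleK) e]|y /in_cell e].
  exact/in_cell.
by split; [apply: gU Ux|rewrite e].
Qed.

Lemma genpart_cellVset0 k U n : genset k U ->
  genpart k U n = set0 \/
  exists2 x, U x & genpart k U n = cube_set (cell k x).
Proof.
move=> gU; have [->|/set0P[x [Ux <-]]] := eqVneq (genpart k U n) set0.
  by left.
by right; exists x => //; exact: genpart_cell.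
Qed.

Lemma measurable_genpart k U n : genset k U -> measurable (genpart k U n).
Proof.
move=> /(@genpart_cellVset0 _ _ n)[->|[x _ ->]]//; exact: measurable_cube.
Qed.

Lemma trivIset_genpart k U : trivIset setT (genpart k U).
Proof. by move=> i j _ _ [x [[_ <-] [_ <-]]]. Qed.

Lemma bigcup_genpart k U : \bigcup_n genpart k U n = U.
Proof.
apply/seteqP; split => [x [n _ []]//|x Ux].
by exists (pickle (idx k x)).
Qed.

Lemma measurable_genset k U : genset k U -> measurable U.
Proof.
move=> gU; rewrite -(bigcup_genpart k U); apply: bigcupT_measurable => n.
exact: measurable_genpart.
Qed.

Lemma measurable_genfun k f : (forall x y, idx k x = idx k y -> f x = f y) ->
  measurable_fun setT f.
Proof.
move=> fk _ B mB; rewrite setTI; apply: (@measurable_genset k).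
by move=> x y xy /=; rewrite (fk _ _ xy).
Qed.

Lemma le_integral_genset k U (F G : T -> \bar R) : genset k U ->
  measurable_fun setT F -> measurable_fun setT G ->
  (forall x, 0 <= F x)%E -> (forall x, 0 <= G x)%E ->
  (forall x, U x -> \int[mu]_(y in cube_set (cell k x)) F y <=
                    \int[mu]_(y in cube_set (cell k x)) G y)%E ->
  (\int[mu]_(y in U) F y <= \int[mu]_(y in U) G y)%E.
Proof.
move=> gU mF mG F0 G0 FG; rewrite -(bigcup_genpart k U).
have mP n := measurable_genpart n gU.
have mT := @measurable_funS _ _ _ _ setT (\bigcup_n genpart k U n) _ measurableT.
rewrite !ge0_integral_bigcup//; try exact: trivIset_genpart; try exact: mT.
apply: lee_nneseries => [n _ _|n _]; first exact: integral_ge0.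
have [->|[x Ux ->]] := genpart_cellVset0 n gU; first by rewrite !integral_set0.
exact: FG.
Qed.

End Grids.

(** * Averages over cells and the dyadic weak-type inequality *)

Section Averages.
Variable R : realType.
Variable d : nat.
Local Notation T := (Rd R d).
Local Notation mu := (leb R d).
Implicit Types (k l : int) (x y : T) (f : T -> R) (Q P : cube R d).

Definition locint f := measurable_fun setT f /\
  forall Q, is_cube Q -> (\int[mu]_(x in cube_set Q) (`|f x|)%:E < +oo)%E.

(** An infinite average would become 0 here; for [locint] functions [avE] excludes this. *)
Definition av f Q : R := fine (avg Q f).

Lemma measurable_absE f : measurable_fun setT f ->
  measurable_fun setT (fun x => (`|f x|)%:E).
Proof.
by move=> mf; apply/measurable_EFinP; exact: measurableT_comp.
Qed.

Lemma integral_absE_ge0 f (A : set T) : (0 <= \int[mu]_(x in A) (`|f x|)%:E)%E.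
Proof. by apply: integral_ge0 => x _; rewrite lee_fin. Qed.

Lemma avg_cube f Q : is_cube Q ->
  avg Q f = ((side Q ^+ d)^-1%:E * \int[mu]_(x in cube_set Q) (`|f x|)%:E)%E.
Proof.
by move=> Q0; rewrite /avg leb_cube// inver gt_eqF// exprn_gt0.
Qed.

Lemma avg_ge0 f Q : is_cube Q -> (0 <= avg Q f)%E.
Proof.
move=> Q0; rewrite avg_cube// mule_ge0 ?integral_absE_ge0//.
by rewrite lee_fin invr_ge0 exprn_ge0// ltW.
Qed.

Lemma integral_avg f Q : is_cube Q ->
  (\int[mu]_(x in cube_set Q) (`|f x|)%:E = avg Q f * (side Q ^+ d)%:E)%E.
Proof.
move=> Q0; rewrite avg_cube// muleAC -EFinM mulVf ?mul1e//.
by rewrite gt_eqF// exprn_gt0.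
Qed.

Lemma av_ge0 f Q : is_cube Q -> 0 <= av f Q.
Proof. by move=> Q0; apply: fine_ge0; exact: avg_ge0. Qed.

Lemma avE f Q : locint f -> is_cube Q -> avg Q f = (av f Q)%:E.
Proof.
move=> [mf lf] Q0; rewrite /av fineK// avg_cube// fin_numM//.
by rewrite ge0_fin_numE ?lf// integral_absE_ge0.
Qed.

Lemma integral_av f Q : locint f -> is_cube Q ->
  (\int[mu]_(x in cube_set Q) (`|f x|)%:E = (av f Q * side Q ^+ d)%:E)%E.
Proof. by move=> lf Q0; rewrite integral_avg// avE// -EFinM. Qed.

Lemma av_sub f Q P : locint f -> is_cube P -> is_cube Q ->
  cube_set P `<=` cube_set Q -> av f P * side P ^+ d <= av f Q * side Q ^+ d.
Proof.
move=> lf P0 Q0 PQ; rewrite -lee_fin -!integral_av//.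
apply: ge0_subset_integral => //; try exact: measurable_cube.
exact: measurable_funS (measurable_absE lf.1).
Qed.

Variable D : grid R d.
Local Notation cell := (cell D).
Local Notation idx := (idx D).

Lemma av_parent f k x : locint f -> av f (cell k x) <= 2 ^+ d * av f (cell (k + 1) x).
Proof.
move=> lf; have h0 := gh_gt0 D k.
have := @av_sub f (cell (k + 1) x) (cell k x) lf (is_cube_qcube _ _ _)
  (is_cube_qcube _ _ _).
have kk : k <= k + 1 by rewrite ler_wpDr.
move=> /(_ (@sub_cell _ _ D k (k + 1) x kk)) /=.
by rewrite ghS exprMn [2 ^+ d * _]mulrC mulrA ler_pM2r// exprn_gt0.
Qed.

(** Descending from [cell k x], stop at the first cell whose average reaches [lam]. The stopping
    cells are disjoint and fill the set on the left, and on each of them the inequality is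
    immediate. *)
Lemma weak_type f k x (lam : R) : locint f -> 0 <= lam ->
  (lam%:E * mu [set y | idx k y = idx k x /\
      exists n : nat, (lam <= av f (cell (k - n%:Z) y))%R]
   <= \int[mu]_(y in cube_set (cell k x)) (`|f y|)%:E)%E.
Proof.
move=> lf lam0; set Z := [set y | _].
pose A n : set T := [set y | [/\ idx k y = idx k x,
  lam <= av f (cell (k - n%:Z) y) &
  forall m, (m < n)%N -> av f (cell (k - m%:Z) y) < lam]].
have gA n : genset D (k - n%:Z) (A n).
  move=> y z yz [a1 a2 a3].
  have yzm m : (m <= n)%N -> idx (k - m%:Z) y = idx (k - m%:Z) z.
    by move=> mn; apply: idx_le yz; rewrite lerD2l lerN2.
  split; first by rewrite -a1; have /= := yzm 0%N isT; rewrite subr0.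
  - by rewrite -(cell_eq yz).
  - by move=> m mn; rewrite -(cell_eq (yzm m (ltnW mn))); exact: a3.
have mA n := measurable_genset (gA n).
have UA : \bigcup_n A n = Z.
  apply/seteqP; split => [y [n _ [a1 a2 _]]|y [y1 exn]].
    by split => //; exists n.
  have [n lamn nmin] := ex_minnP exn.
  exists n => //; split => // m mn; rewrite ltNge; apply/negP => /nmin.
  by rewrite leqNgt mn.
have tA : trivIset setT A.
  move=> i j _ _ [y [[_ i1 i2] [_ j1 j2]]].
  case: (ltngtP i j) => // [ij|ji].
    by have := j2 _ ij; rewrite ltNge i1.
  by have := i2 _ ji; rewrite ltNge j1.
have mZ : measurable Z by rewrite -UA; exact: bigcupT_measurable.
have mf := measurable_absE lf.1.
rewrite -(@integral_cst _ _ _ mu Z mZ).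
apply: (@le_trans _ _ (\int[mu]_(y in Z) (`|f y|)%:E)%E); last first.
  apply: ge0_subset_integral => //; try exact: measurable_cube.
    exact: measurable_funS mf.
  by move=> y [y1 _]; exact/in_cell.
rewrite -UA !ge0_integral_bigcup//; last exact: measurable_funS mf.
apply: lee_nneseries => [n _ _|n _]; first by apply: integral_ge0.
apply: (le_integral_genset (gA n)) => // y [_ a2 _].
rewrite integral_cst ?integral_av//; [|exact: is_cube_qcube|exact: measurable_cube].
rewrite [X in (_ * X)%E]leb_cube -?EFinM ?lee_fin; last exact: is_cube_qcube.
by rewrite ler_wpM2r// exprn_ge0// ltW// gh_gt0.
Qed.

End Averages.

(** * Dyadic differentiation *)

Lemma exprz_floor_ln (R : realType) (a v : R) : 1 < a -> 0 < v ->
  a ^ Num.floor (ln v / ln a) <= v < a ^ (Num.floor (ln v / ln a) + 1).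
Proof.
move=> a1 v0; have a0 : 0 < a by exact: lt_trans a1.
have la : 0 < ln a by rewrite ln_gt0.
have := floor_itv (ln v / ln a); set j := Num.floor _.
rewrite ler_pdivlMr// ltr_pdivrMr// => /andP[j1 j2].
have e z : a ^ z = expR (z%:~R * ln a).
  by rewrite -powR_intmul ?ltW// /powR gt_eqF.
by rewrite !e -{1 2}(lnK v0) ler_expR ltr_expR j1.
Qed.

Section Approximation.
Variable R : realType.
Variable d : nat.
Local Notation T := (Rd R d).
Variable D : grid R d.
Variable k : int.
Local Notation cell := (cell D).
Implicit Types (A B U : set T) (f : T -> R) (x y : T).

Lemma gh_subn n : gh D (k - n%:Z) = gh D k / 2 ^+ n.
Proof.
elim: n => [|n IH]; first by rewrite subr0 expr0 divr1.
have := ghS D (k - n.+1%:Z).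
rewrite (_ : k - n.+1%:Z + 1 = k - n%:Z); last by rewrite -addn1 PoszD; ring.
by rewrite IH => h; rewrite exprS invfM mulrCA h mulKf.
Qed.

Lemma gh_small (e : R) : 0 < e -> exists n : nat, gh D (k - n%:Z) <= e.
Proof.
move=> e0; have h0 := gh_gt0 D k.
exists (Num.bound (gh D k / e)); set n := Num.bound _.
rewrite gh_subn ler_pdivrMr ?exprn_gt0// mulrC -ler_pdivrMr//.
have /ltW := archi_boundP (ltW (divr_gt0 h0 e0)) => /le_trans; apply.
by rewrite -natrX ler_nat ltnW// ltn_expl.
Qed.

Variable rho : {measure set T -> \bar R}.
Hypothesis rho_fin : (rho setT < +oo)%E.

(** Later [rho] is [mu] restricted to a cell, and the approximating sets are unions of its small
    subcells. *)
Definition approximable A := measurable A /\ forall e : R, 0 < e ->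
  exists n : nat, exists2 U, genset D (k - n%:Z) U & (rho (A `+` U) < e%:E)%E.

Lemma measurable_setY A B : measurable A -> measurable B -> measurable (A `+` B).
Proof. by move=> mA mB; apply: measurableU; exact: measurableD. Qed.

Lemma approximable_genset n U : genset D (k - n%:Z) U -> approximable U.
Proof.
move=> gU; split => [|e e0]; first exact: measurable_genset gU.
by exists n, U => //; rewrite setYK measure0 lte_fin.
Qed.

Lemma approximableT A : measurable A ->
  (forall e : R, 0 < e -> exists2 B, approximable B & (rho (A `+` B) < e%:E)%E) ->
  approximable A.
Proof.
move=> mA apA; split => // e e0.
have [B [mB apB] AB] := apA _ (divr_gt0 e0 (ltr0Sn _ 1)).
have [n [U gU BU]] := apB _ (divr_gt0 e0 (ltr0Sn _ 1)).
exists n, U => //.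
have mU := measurable_genset gU.
apply: (@le_lt_trans _ _ (rho ((A `+` B) `|` (B `+` U)))%E).
  apply: le_measure; rewrite ?inE.
  - exact: measurable_setY.
  - by apply: measurableU; exact: measurable_setY.
  - move=> x [[Ax Ux]|[Ux Ax]]; have [Bx|Bx] := pselect (B x).
    + by right; left.
    + by left; left.
    + by left; right.
    + by right; right.
apply: le_lt_trans; first by apply: measureU2; exact: measurable_setY.
by rewrite [e in e%:E](splitr e) EFinD lteD.
Qed.

Lemma approximableU A B : approximable A -> approximable B -> approximable (A `|` B).
Proof.
move=> [mA apA] [mB apB]; split => [|e e0]; first exact: measurableU.
have [n [U gU AU]] := apA _ (divr_gt0 e0 (ltr0Sn _ 1)).
have [m [V gV BV]] := apB _ (divr_gt0 e0 (ltr0Sn _ 1)).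
exists (maxn n m), (U `|` V).
  have gU' : genset D (k - (maxn n m)%:Z) U.
    by apply: genset_le gU; rewrite lerD2l lerN2 lez_nat leq_maxl.
  have gV' : genset D (k - (maxn n m)%:Z) V.
    by apply: genset_le gV; rewrite lerD2l lerN2 lez_nat leq_maxr.
  by move=> x y xy [Ux|Vx]; [left; apply: gU' Ux|right; apply: gV' Vx].
have mU := measurable_genset gU; have mV := measurable_genset gV.
apply: (@le_lt_trans _ _ (rho ((A `+` U) `|` (B `+` V)))%E).
  apply: le_measure; rewrite ?inE.
  - by apply: measurable_setY; exact: measurableU.
  - by apply: measurableU; exact: measurable_setY.
  - by move=> x [[[Ax|Bx] /not_orP[]]|[[Ux|Vx] /not_orP[]]] *;
    [left; left|right; left|left; right|right; right].
apply: le_lt_trans; first by apply: measureU2; exact: measurable_setY.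
by rewrite [e in e%:E](splitr e) EFinD lteD.
Qed.

(** Finiteness of [rho] is used for countable unions: what the partial unions miss decreases to the
    empty set, so its measure tends to 0. *)
Lemma sigma_algebra_approximable : sigma_algebra setT approximable.
Proof.
have ap0 : approximable set0 by apply: (@approximable_genset 0).
split => // [A [mA apA]|A apA].
- split => [|e e0]; first exact: measurableD.
  have [n [U gU AU]] := apA _ e0.
  exists n, (~` U).
    by move=> x y xy Ux Uy; apply: Ux; apply: gU Uy.
  rewrite (_ : _ `+` _ = A `+` U)//.
  by apply/seteqP; split => x; have [?|?] := pselect (A x);
    have [?|?] := pselect (U x); rewrite /setY /setD /setU /setC /setT /mkset; tauto.
- have mA n : measurable (A n) by have [] := apA n.
  have mU : measurable (\bigcup_n A n) by exact: bigcupT_measurable.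
  have apF n : approximable (\big[setU/set0]_(i < n) A i).
    elim: n => [|n IH]; first by rewrite big_ord0.
    by rewrite big_ord_recr/=; exact: approximableU.
  apply: approximableT => // e e0.
  pose F n := \bigcup_i A i `\` \big[setU/set0]_(i < n) A i.
  have mF n : measurable (F n) by apply: measurableD => //; case: (apF n).
  have capF : \bigcap_n F n = set0.
    apply/seteqP; split => // x Fx.
    have [[i _ Aix] _] := Fx 0%N Logic.I.
    have [_] := Fx i.+1 Logic.I; apply.
    by rewrite -bigcup_mkord; exists i => /=.
  have : rho \o F @ \oo --> rho (\bigcap_n F n).
    apply: nonincreasing_cvg_mu => //.
    + apply: le_lt_trans rho_fin; apply: le_measure; rewrite ?inE//.
    + by rewrite capF.
    + move=> m n mn; apply/subsetPset => x [Ax NAx]; split => //.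
      apply: contra_not NAx; rewrite -!bigcup_mkord => -[i /= im Aix].
      by exists i => //=; exact: leq_trans mn.
  rewrite capF measure0 => /fine_cvgP[Ffin /cvgrPdist_lt/(_ e e0)].
  move=> /(filterI Ffin)[n _ /(_ n (leqnn n))[/= fn Fn]].
  exists (\big[setU/set0]_(i < n) A i) => //.
  rewrite (_ : _ `+` _ = F n); last first.
    apply/seteqP; split => [x [//|[+ NAx]]|x Fx]; last by left.
    by rewrite -bigcup_mkord => -[i _ Aix]; case: NAx; exists i.
  rewrite -(fineK fn) lte_fin.
  by apply: le_lt_trans Fn; rewrite /= add0r normrN ler_norm.
Qed.

Lemma measurable_approximable A : measurable A -> approximable A.
Proof.
move: A; apply: measurable_sub_coord; first exact: sigma_algebra_approximable.
move=> i t.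
(* The half-space is exhausted by the cells contained in it: its inequality is strict and the sides
   of the cells tend to 0. *)
pose U n : set T := [set x | corner (cell (k - n%:Z) x) i + gh D (k - n%:Z) <= t].
rewrite (_ : [set x | _] = \bigcup_n U n); last first.
  apply/seteqP; split => [x /= xt|x [n _ /= Ux]].
  - have [n hn] : exists n : nat, gh D (k - n%:Z) <= t - coord x i.
      by apply: gh_small; rewrite subr_gt0.
    exists n => //; rewrite /U /mkset.
    have /(_ i)/andP[cx _] := @cell_self _ _ D (k - n%:Z) x.
    by lra.
  - have /(_ i)/andP[_ /=] := @cell_self _ _ D (k - n%:Z) x.
    by move=> /lt_le_trans; apply.
have [_ _] := sigma_algebra_approximable; apply => n.
apply: (@approximable_genset n) => x y xy.
by rewrite /U /mkset (cell_eq xy).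
Qed.

End Approximation.

Section Differentiation.
Variable R : realType.
Variable d : nat.
Local Notation T := (Rd R d).
Local Notation mu := (leb R d).
Variable D : grid R d.
Local Notation cell := (cell D).
Variables (k : int) (x0 : T) (f : T -> R).
Hypothesis lf : locint f.

Let Q := cube_set (cell k x0).

Lemma measurable_av_cell l : measurable_fun setT (fun y => av f (cell l y)).
Proof. by apply: (@measurable_genfun _ _ D l) => x y xy; rewrite (cell_eq xy). Qed.

(* Approximate the set by a union of small cells: those meeting the set have
   averages of |f| at most lam. *)
Lemma large_over_averages_null (lam N : R) : 0 < lam ->
  mu.-negligible [set y | [/\ Q y, 2 * lam <= `|f y| <= N &
    forall n : nat, av f (cell (k - n%:Z) y) <= lam]].
Proof.
move=> lam0; set A := [set y | _].
have mQ : measurable Q by exact: measurable_cube.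
have mf := lf.1; have mfE := measurable_absE mf.
have mA : measurable A.
  rewrite (_ : A = Q `&` (setT `&` (fun y => `|f y|) @^-1` `[2 * lam, N]) `&`
      \bigcap_n (setT `&` (fun y => av f (cell (k - n%:Z) y)) @^-1` `]-oo, lam])).
    apply: measurableI.
    + apply: measurableI => //.
      have : measurable_fun setT (fun y => `|f y|) by exact: measurableT_comp.
      by apply => //; exact: measurable_itv.
    + apply: bigcapT_measurable => n.
      by apply: measurable_av_cell => //; exact: measurable_itv.
  apply/seteqP; split => [y [Qy fy ay]|y [[Qy [_ +]] ay]].
    split; first by split => //; split => //=; rewrite in_itv.
    by move=> n _; split => //=; rewrite in_itv/=; exact: ay.
  rewrite /= in_itv => fy; split => // n.
  by have [_] := ay n Logic.I; rewrite /= in_itv.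
suff muA : mu A = 0%E by exists A; split.
have Qfin : (mu Q < +oo)%E by apply: leb_cube_lty; exact: is_cube_qcube.
have AQ : A `<=` Q by move=> y [].
have Afin : mu A \is a fin_num.
  rewrite ge0_fin_numE//; apply: le_lt_trans Qfin.
  by apply: le_measure; rewrite ?inE.
have [->//|/negP A0] := eqVneq (mu A) 0%E.
pose a := fine (mu A).
have a0 : 0 < a.
  by rewrite fine_gt0// lt0e measure_ge0 -ge0_fin_numE// Afin !andbT; apply/negP.
pose NN := `|N| + lam.
have NN0 : 0 < NN by rewrite ltr_wpDl.
(* The final comparison reads [lam * a <= (lam + |N|) * e]; this [e] makes the right side half of
   the left. *)
pose e := lam * a / (2 * NN).
have e0 : 0 < e by rewrite divr_gt0// mulr_gt0.
have rho_fin : (mrestr mu mQ setT < +oo)%E by rewrite /mrestr setTI.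
have [_ /(_ _ e0)[n [U gU]]] := @measurable_approximable R d D k _ rho_fin A mA.
rewrite /= /mrestr => AU.
have mU := measurable_genset gU.
(* Discarding the cells of [U] with large average loses no point of [A], since every cell around
   such a point has average at most [lam]. *)
pose V := [set y | [/\ Q y, U y & av f (cell (k - n%:Z) y) <= lam]].
have gV : genset D (k - n%:Z) V.
  move=> y z yz [Qy Uy Vy]; split.
  - move: Qy => /in_cell Qy; apply/in_cell; rewrite -Qy; apply/esym.
    by apply: idx_le yz; rewrite gerDl oppr_le0.
  - exact: gU Uy.
  - by rewrite -(cell_eq yz).
have mV := measurable_genset gV.
have mD : measurable ((A `+` U) `&` Q).
  by apply: measurableI => //; exact: measurable_setY.
have VA : (mu V <= a%:E + e%:E)%E.
  apply: (@le_trans _ _ (mu (A `|` ((A `+` U) `&` Q)))).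
    apply: le_measure; rewrite ?inE//; first exact: measurableU.
    move=> y [Qy Uy _]; have [Ay|Ay] := pselect (A y); first by left.
    by right; split => //; right.
  apply: le_trans; first exact: measureU2.
  by rewrite fineK// leeD2l// ltW.
have intV : (\int[mu]_(y in V) (`|f y|)%:E <= lam%:E * mu V)%E.
  rewrite -(@integral_cst _ _ _ mu V mV).
  apply: (le_integral_genset gV) => //.
    by move=> y; rewrite lee_fin ltW.
  move=> y [_ _ Vy]; rewrite integral_av//; last exact: is_cube_qcube.
  rewrite integral_cst; last exact: measurable_cube.
  rewrite [X in (_ * X)%E]leb_cube; last exact: is_cube_qcube.
  by rewrite -EFinM lee_fin ler_wpM2r// exprn_ge0// ltW// gh_gt0.
(* The truncation at [N] serves here: it turns the small measure of [A] outside [U] into a small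
   integral. *)
have intD : (\int[mu]_(y in (A `\` U)) (`|f y|)%:E <= `|N|%:E * e%:E)%E.
  apply: (@le_trans _ _ (\int[mu]_(y in (A `\` U)) (`|N|)%:E)%E).
    apply: ge0_le_integral => //.
    - exact: measurableD.
    - exact: measurable_funS mfE.
    - move=> y [[_ /andP[_ fN] _] _]; rewrite lee_fin.
      exact: le_trans fN (ler_norm _).
  rewrite integral_cst; last exact: measurableD.
  rewrite lee_wpmul2l//; apply: le_trans (ltW AU).
  apply: le_measure; rewrite ?inE//; first exact: measurableD.
  by move=> y [Ay Uy]; split; [left|exact: AQ].
have intA : ((2 * lam)%:E * mu A <= \int[mu]_(y in A) (`|f y|)%:E)%E.
  rewrite -(@integral_cst _ _ _ mu A mA); apply: ge0_le_integral => //.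
  - by move=> y _; rewrite lee_fin; lra.
  - exact: measurable_funS mfE.
  - by move=> y [_ /andP[fy _] _].
have intU : (\int[mu]_(y in A) (`|f y|)%:E <=
    \int[mu]_(y in V) (`|f y|)%:E + \int[mu]_(y in (A `\` U)) (`|f y|)%:E)%E.
  rewrite -ge0_integral_setU//; last 3 first.
  - exact: measurableD.
  - exact: measurable_funS mfE.
  - by apply/disj_setPS => y [[_ Uy _] [_]].
  apply: ge0_subset_integral => //.
  - by apply: measurableU => //; exact: measurableD.
  - exact: measurable_funS mfE.
  - move=> y Ay; have [Uy|Uy] := pselect (U y); last by right.
    by left; have [? ? h] := Ay; split.
exfalso.
have : ((2 * lam)%:E * mu A <= lam%:E * (a%:E + e%:E) + `|N|%:E * e%:E)%E.
  apply: le_trans intA _; apply: le_trans intU _; apply: leeD => //.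
  apply: le_trans intV _; rewrite lee_wpmul2l// lee_fin; exact: ltW.
rewrite -(fineK Afin) -/a -!EFinD -!EFinM lee_fin.
have : NN * e = lam * a / 2 by rewrite /e; field; rewrite gt_eqF.
rewrite /NN mulrDl mulrDr => E1.
have : 0 < lam * a by rewrite mulr_gt0.
by lra.
Qed.

(** If no average exceeds [|f y| / 4], then the first power of two above [|f y| / 4] bounds all
    averages while its double is at most [|f y|]. So [y] lies in one of countably many null sets,
    indexed by this power and by an integer bound for [|f y|]. *)
Lemma differentiation : {ae mu, forall y, Q y -> 0 < `|f y| ->
  exists n : nat, `|f y| / 4 < av f (cell (k - n%:Z) y)}.
Proof.
pose A (jN : int * nat) := [set y | [/\ Q y,
    2 * (2 ^ jN.1 : R) <= `|f y| <= jN.2%:R &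
    forall n : nat, av f (cell (k - n%:Z) y) <= 2 ^ jN.1]].
pose B n := if pickle_inv n is Some jN then A jN else set0.
have nB n : mu.-negligible (B n).
  rewrite /B; case: (pickle_inv n) => [[j N]|]; last exact: negligible_set0.
  by apply: large_over_averages_null; exact: exprz_gt0.
apply: (negligibleS _ (negligible_bigcup nB)) => y /=.
rewrite not_implyE => -[Qy]; rewrite not_implyE => -[fy0 /forallNP nav].
have fy4 : 0 < `|f y| / 4 by rewrite divr_gt0.
have [j /andP[j1 j2]] : exists j : int, 2 ^ j <= `|f y| / 4 < 2 ^ (j + 1).
  by eexists; apply: exprz_floor_ln fy4; rewrite ltr1n.
have e2 : 2 ^ (j + 1) = 2 * (2 ^ j : R) by rewrite expfzDr ?pnatr_eq0// expr1z mulrC.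
exists (pickle (j + 1, Num.bound `|f y|)); first exact: Logic.I.
rewrite /B pickleK_inv /A /mkset [(_, _).1]/= [(_, _).2]/=; split => //.
- rewrite e2; apply/andP; split; first by lra.
  by apply/ltW/archi_boundP.
- by move=> n; have /negP := nav n; rewrite -leNgt => /le_trans; apply; exact: ltW.
Qed.

End Differentiation.

(** * The reverse Hoelder inequality *)

Section PowerInequality.
Variable R : realType.
Implicit Types u m x c del : R.

(** Young's inequality for [u ^ del] and 1 with exponents [1 / del] and [1 / (1 - del)]; the second
    one degenerates at [del = 1], hence the case distinction. *)
Lemma powR_Bernoulli u del : 0 <= u -> 0 < del <= 1 ->
  u `^ del <= 1 + del * (u - 1).
Proof.
move=> u0 /andP[d0]; rewrite le_eqVlt => /predU1P[->|d1].
  by rewrite powRr1//; lra.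
have d1' : 0 < 1 - del by rewrite subr_gt0.
have := @conjugate_powR _ (u `^ del) 1 del^-1 (1 - del)^-1
  (powR_ge0 _ _) ler01.
rewrite !invr_gt0 !invrK => /(_ d0 d1'); rewrite addrC subrK => /(_ erefl).
rewrite mulr1 -powRrM divff ?gt_eqF// powRr1// powR1.
by lra.
Qed.

(** The refinement step on one cell: [m] is the old maximal average, [x] the new average, [c] the
    doubling constant. By homogeneity only [u = x / m] in []1, c]] matters, and there Bernoulli
    gives [u (u^del - 1) <= c del (u - 1) <= c del (u^(1 + del) - 1)]. *)
Lemma powR_max_ineq x m c del : 0 <= m -> 0 <= x <= c * m -> 0 < del <= 1 ->
  x * Num.max m x `^ del + c * del * m `^ (1 + del) <=
  x * m `^ del + c * del * Num.max m x `^ (1 + del).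
Proof.
move=> m0 /andP[x0 xcm] /andP[d0 d1].
have [xm|mx] := leP x m; first by rewrite lexx.
move: m0; rewrite le_eqVlt => /predU1P[m0|m0].
  by move: xcm mx; rewrite -m0 mulr0; lra.
pose u := x / m.
have xE : x = u * m by rewrite /u divfK// gt_eqF.
have u1 : 1 < u by rewrite /u ltr_pdivlMr// mul1r.
have uc : u <= c by rewrite /u ler_pdivrMr.
have u0 : 0 <= u by lra.
have B := powR_Bernoulli u0 (introT andP (conj d0 d1)).
have U : u <= u `^ (1 + del) by apply: le1r_powR; lra.
have mp : m `^ (1 + del) = m * m `^ del.
  by rewrite powRD ?powRr1 ?(ltW m0)// (gt_eqF m0) implybT.
rewrite xE !(powRM _ u0 (ltW m0)) mp.
have p0 : 0 < m * m `^ del by rewrite mulr_gt0// powR_gt0.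
have -> : u * m * (u `^ del * m `^ del) + c * del * (m * m `^ del)
    = (u * u `^ del + c * del) * (m * m `^ del) by ring.
have -> : u * m * m `^ del + c * del * (u `^ (1 + del) * (m * m `^ del)) =
   (u + c * del * u `^ (1 + del)) * (m * m `^ del) by ring.
rewrite ler_pM2r//.
have : u * u `^ del <= u * (1 + del * (u - 1)) by rewrite ler_wpM2l.
have : c * del * (u - 1) <= c * del * (u `^ (1 + del) - 1).
  by rewrite ler_wpM2l ?lerB// mulr_ge0//; lra.
have : u * (del * (u - 1)) <= c * (del * (u - 1)).
  by rewrite ler_wpM2r// mulr_ge0//; lra.
by lra.
Qed.

(** The steps telescope to [al n <= al 0 + L * be n], whose last term is at most half of [al n]. *)
Lemma absorption (L C : R) (al be : nat -> R) : 0 <= L -> L * C <= 2^-1 ->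
  (forall n, 0 <= al n) -> (forall n, 0 <= be n) ->
  (forall n, al n.+1 + L * be n <= al n + L * be n.+1) ->
  (forall n, be n <= C * al n) -> forall n, al n <= 2 * al 0%N.
Proof.
move=> L0 LC al0 be0 step bCa n.
have tele : al n + L * be 0%N <= al 0%N + L * be n.
  by elim: n => [//|n IH]; have := step n; lra.
have : L * be n <= L * (C * al n) by rewrite ler_wpM2l.
have : L * C * al n <= 2^-1 * al n by rewrite ler_wpM2r.
have : 0 <= L * be 0%N by rewrite mulr_ge0.
by lra.
Qed.

End PowerInequality.

Section ReverseHolderCell.
Variable R : realType.
Variable d : nat.
Local Notation T := (Rd R d).
Local Notation mu := (leb R d).
Variable D : grid R d.
Local Notation cell := (cell D).
Local Notation idx := (idx D).
Variables (k : int) (x0 : T) (w : T -> R) (C del : R).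
Hypothesis lw : locint w.
Hypothesis w0 : forall y, 0 <= w y.
Hypothesis C0 : 0 <= C.
Hypothesis A1 : forall P, is_cube P ->
  {ae mu, forall y, cube_set P y -> av w P <= C * w y}.
Hypothesis del01 : 0 < del <= 1.
Hypothesis delC : 2 ^+ d * del * C <= 2^-1.

Let del0 : 0 < del. Proof. by case/andP: del01. Qed.
Let Q := cube_set (cell k x0).
Let vol := gh D k ^+ d.
Let L := 2 ^+ d * del.

Let L0 : 0 <= L. Proof. by rewrite mulr_ge0// ltW. Qed.
Let mQ : measurable Q. Proof. exact: measurable_cube. Qed.

(** The dyadic maximal function of [w] truncated to generations [k - n] to [k]. In the successor
    branch [n] still denotes the whole argument [n'.+1]. *)
Fixpoint dmax (n : nat) (y : T) : R :=
  match n with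
  | 0 => av w (cell k y)
  | n'.+1 => Num.max (dmax n' y) (av w (cell (k - n%:Z) y))
  end.

Lemma dmax_gen n y z : idx (k - n%:Z) y = idx (k - n%:Z) z -> dmax n y = dmax n z.
Proof.
elim: n => [|n IH] yz /=.
  by rewrite subr0 in yz; rewrite (cell_eq yz).
rewrite (cell_eq yz) (IH _)//; apply: idx_le yz.
by rewrite lerD2l lerN2 lez_nat.
Qed.

Lemma dmax_ge_av n y : av w (cell (k - n%:Z) y) <= dmax n y.
Proof. by case: n => [|n] /=; rewrite ?subr0// le_max lexx orbT. Qed.

Lemma dmax_ge0 n y : 0 <= dmax n y.
Proof. exact: le_trans (av_ge0 _ (is_cube_qcube _ _ _)) (dmax_ge_av n y). Qed.

Lemma av_le_dmax n y : av w (cell (k - n.+1%:Z) y) <= 2 ^+ d * dmax n y.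
Proof.
apply: le_trans (av_parent D _ _ lw) _.
rewrite (_ : k - n.+1%:Z + 1 = k - n%:Z); last by rewrite -addn1 PoszD; ring.
by rewrite ler_wpM2l// dmax_ge_av.
Qed.

Lemma dmax_bound n y : Q y -> dmax n y <= (2 ^+ d) ^+ n * av w (cell k x0).
Proof.
move=> /in_cell Qy; elim: n => [|n IH].
  by rewrite /= expr0 mul1r (cell_eq Qy).
have d1 : 1 <= 2 ^+ d :> R by rewrite exprn_ege1// ler1n.
have h : 2 ^+ d * dmax n y <= (2 ^+ d) ^+ n.+1 * av w (cell k x0).
  by rewrite exprS -mulrA ler_wpM2l// exprn_ge0.
rewrite /= ge_max; apply/andP; split; last exact: le_trans (av_le_dmax n y) h.
by apply: le_trans h; rewrite ler_peMl// dmax_ge0.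
Qed.

Lemma measurable_dmax n : measurable_fun setT (dmax n).
Proof. by apply: (@measurable_genfun _ _ D (k - n%:Z)); exact: dmax_gen. Qed.

(** The null set in [A1] depends on the cube, but only the countably many cells of generations at
    most [k] matter, so one null set serves for all [n]. *)
Lemma dmax_A1 : {ae mu, forall y, Q y -> forall n, dmax n y <= C * w y}.
Proof.
have A1l n : {ae mu, forall y, av w (cell (k - n%:Z) y) <= C * w y}.
  pose B i := \bigcup_(m in [set m | pickle m = i])
    [set y | ~ (cube_set (qcube D (k - n%:Z) m) y ->
       av w (qcube D (k - n%:Z) m) <= C * w y)].
  have nB i : mu.-negligible (B i).
    have [[m mi]|nm] := pselect (exists m : {ffun 'I_d -> int}, pickle m = i).
      apply: (negligibleS _ (A1 (is_cube_qcube D (k - n%:Z) m))).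
      by move=> y [m' /= m'i]; rewrite (_ : m' = m)//; apply: (pcan_inj pickleK); rewrite mi.
    apply: (negligibleS _ (@negligible_set0 _ _ _ mu)) => y [m /= mi].
    by case: nm; exists m.
  apply: (negligibleS _ (negligible_bigcup nB)) => y /= Ny.
  exists (pickle (idx (k - n%:Z) y)) => //.
  by exists (idx (k - n%:Z) y) => //= /(_ (cell_self D _ _)).
apply: filterS (ae_foralln A1l) => y Ay _ n.
elim: n => [|n IH] /=; first by have := Ay 0%N; rewrite subr0.
by rewrite ge_max IH Ay.
Qed.

Let measE (g : T -> R) : measurable_fun setT g ->
  measurable_fun Q (fun y => (g y)%:E).
Proof. by move=> mg; apply: measurable_funTS; exact/measurable_EFinP. Qed.

Let mpow n p : measurable_fun setT (fun y => dmax n y `^ p).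
Proof. exact: measurableT_comp (measurable_powR _) (measurable_dmax n). Qed.

Let mwpow n p : measurable_fun setT (fun y => w y * dmax n y `^ p).
Proof. by apply: measurable_funM => //; exact: lw.1. Qed.

Let a n := (\int[mu]_(y in Q) (w y * dmax n y `^ del)%:E)%E.
Let b n := (\int[mu]_(y in Q) (dmax n y `^ (1 + del))%:E)%E.

(** Where [dmax] is constant, the integrands below are affine in [w], so that their integrals see
    [w] only through its average. *)
Let int_affine P (c1 c2 : R) : is_cube P -> 0 <= c1 -> 0 <= c2 ->
  (\int[mu]_(y in cube_set P) (w y * c1 + c2)%:E =
   ((c1 * av w P + c2) * side P ^+ d)%:E)%E.
Proof.
move=> P0 c10 c20.
have mP := measurable_cube P.
under eq_integral do rewrite EFinD EFinM muleC.
have mwP : measurable_fun (cube_set P) (fun y => (w y)%:E).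
  by apply: measurable_funTS; apply/measurable_EFinP; exact: lw.1.
rewrite ge0_integralD//; last 2 first.
- by move=> y _; rewrite -EFinM lee_fin mulr_ge0.
- exact: measurable_funeM.
rewrite ge0_integralZl_EFin//; last by move=> y _; rewrite lee_fin.
rewrite integral_cst// [X in (_ + _ * X)%E]leb_cube//.
rewrite (eq_integral (fun y => (`|w y|)%:E)); last first.
  by move=> y _; rewrite ger0_norm.
by rewrite integral_av// -!EFinM -EFinD; congr EFin; ring.
Qed.

Let combE n m : (\int[mu]_(y in Q) (w y * dmax n y `^ del
    + L * dmax m y `^ (1 + del))%:E = a n + L%:E * b m)%E.
Proof.
under eq_integral do rewrite EFinD EFinM.
rewrite ge0_integralD//; last 4 first.
- by move=> y _; rewrite -EFinM lee_fin mulr_ge0// powR_ge0.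
- exact: measE.
- by move=> y _; rewrite lee_fin mulr_ge0// powR_ge0.
- by apply: measE; apply: measurable_funM.
congr (_ + _)%E; under eq_integral do rewrite EFinM.
rewrite ge0_integralZl_EFin//.
- by move=> y _; rewrite lee_fin powR_ge0.
- exact: measE.
Qed.

(** On a cell of generation [k - n.+1] both [dmax n] and [dmax n.+1] are constant, which reduces the
    claim to [powR_max_ineq]. Terms are moved across the inequality to avoid subtraction in the
    extended reals. *)
Let step n : (a n.+1 + L%:E * b n <= a n + L%:E * b n.+1)%E.
Proof.
rewrite -!combE; apply: (@le_integral_genset _ _ D (k - n.+1%:Z)).
- move=> y z yz /in_cell Qy; apply/in_cell; rewrite -Qy; apply/esym.
  by apply: idx_le yz; rewrite gerDl oppr_le0.
- apply/measurable_EFinP; apply: measurable_funD => //; exact: measurable_funM.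
- apply/measurable_EFinP; apply: measurable_funD => //; exact: measurable_funM.
- by move=> y; rewrite lee_fin addr_ge0// mulr_ge0// powR_ge0.
- by move=> y; rewrite lee_fin addr_ge0// mulr_ge0// powR_ge0.
move=> y Qy; set P := cell (k - n.+1%:Z) y.
pose m := dmax n y; pose m' := dmax n.+1 y.
have P0 : is_cube P by exact: is_cube_qcube.
have Em z : cube_set P z -> dmax n z = m /\ dmax n.+1 z = m'.
  move=> /in_cell zy; split; apply: dmax_gen => //.
  by apply: idx_le zy; rewrite lerD2l lerN2 lez_nat.
rewrite (eq_integral (fun z => (w z * m' `^ del + L * m `^ (1 + del))%:E)); last first.
  by move=> z; rewrite inE => /Em[-> ->].
rewrite [leRHS](eq_integral (fun z => (w z * m `^ del + L * m' `^ (1 + del))%:E)); last first.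
  by move=> z; rewrite inE => /Em[-> ->].
rewrite !(int_affine P0 (powR_ge0 _ _) (mulr_ge0 L0 (powR_ge0 _ _))).
rewrite lee_fin ler_wpM2r//.
  by rewrite exprn_ge0// ltW.
rewrite ![_ `^ del * _]mulrC; apply: powR_max_ineq => //; first exact: dmax_ge0.
by rewrite av_ge0//= av_le_dmax.
Qed.

Let x := av w (cell k x0).

Let x_ge0 : 0 <= x. Proof. by apply: av_ge0; exact: is_cube_qcube. Qed.

Let bound n := (2 ^+ d) ^+ n * x.

Let bound_ge0 n : 0 <= bound n. Proof. by rewrite mulr_ge0// exprn_ge0. Qed.

Let powR_dmax_bound n y p : 0 <= p -> Q y -> dmax n y `^ p <= bound n `^ p.
Proof.
move=> p0 Qy; apply: ge0_ler_powR => //; rewrite ?nnegrE ?dmax_ge0//.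
exact: dmax_bound.
Qed.

(** On [Q] doubling bounds [dmax n] by a constant; this finiteness is what allows [absorption], a
    statement on real numbers, to be applied. *)
Let a_fin n : a n \is a fin_num.
Proof.
rewrite ge0_fin_numE; last first.
  by apply: integral_ge0 => y _; rewrite lee_fin mulr_ge0// powR_ge0.
apply: (@le_lt_trans _ _ (\int[mu]_(y in Q) (w y * bound n `^ del + 0)%:E)%E).
  apply: ge0_le_integral => //.
  - by move=> y _; rewrite lee_fin mulr_ge0// powR_ge0.
  - exact: measE.
  - apply: measE; apply: measurable_funD => //; apply: measurable_funM => //.
    exact: lw.1.
  - by move=> y Qy; rewrite lee_fin addr0 ler_wpM2l// powR_dmax_bound// ltW.
by rewrite int_affine ?ltry// ?powR_ge0//; exact: is_cube_qcube.
Qed.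

Let b_fin n : b n \is a fin_num.
Proof.
rewrite ge0_fin_numE; last first.
  by apply: integral_ge0 => y _; rewrite lee_fin powR_ge0.
apply: (@le_lt_trans _ _ (\int[mu]_(y in Q) (w y * 0 + bound n `^ (1 + del))%:E)%E).
  apply: ge0_le_integral => //.
  - by move=> y _; rewrite lee_fin powR_ge0.
  - exact: measE.
  - apply: measE; apply: measurable_funD => //; apply: measurable_funM => //.
    exact: lw.1.
  - move=> y Qy; rewrite lee_fin mulr0 add0r powR_dmax_bound//.
    by rewrite addr_ge0// ltW.
by rewrite int_affine ?ltry// ?powR_ge0//; exact: is_cube_qcube.
Qed.

Let dmax_powS n y : dmax n y `^ (1 + del) = dmax n y * dmax n y `^ del.
Proof.
rewrite powRD ?powRr1 ?dmax_ge0//.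
by rewrite gt_eqF// ltr_wpDl.
Qed.

Let bCa n : (b n <= C%:E * a n)%E.
Proof.
rewrite -ge0_integralZl_EFin//; last 2 first.
- by move=> y _; rewrite lee_fin mulr_ge0// powR_ge0.
- exact: measE.
apply: ae_ge0_le_integral => //.
- by move=> y _; rewrite lee_fin powR_ge0.
- exact: measE.
- by move=> y _; rewrite -EFinM lee_fin !mulr_ge0// powR_ge0.
- by apply: measurable_funeM; exact: measE.
apply: filterS dmax_A1 => y Ay Qy.
by rewrite -EFinM lee_fin dmax_powS mulrA ler_wpM2r ?powR_ge0// Ay.
Qed.

Let a0E : a 0%N = (x `^ (1 + del) * vol)%:E.
Proof.
rewrite /a (eq_integral (fun y => (w y * x `^ del + 0)%:E)); last first.
  by move=> y; rewrite inE => /in_cell Qy; rewrite /= (cell_eq Qy) addr0.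
rewrite int_affine ?powR_ge0//; last exact: is_cube_qcube.
congr EFin; rewrite addr0; congr (_ * _).
rewrite [LHS]mulrC -/x powRD ?powRr1//.
by rewrite gt_eqF// ltr_wpDl.
Qed.

Let a_bound n : (a n <= (2 * (x `^ (1 + del) * vol))%:E)%E.
Proof.
pose al i := fine (a i); pose be i := fine (b i).
have aE i : a i = (al i)%:E by rewrite fineK.
have bE i : b i = (be i)%:E by rewrite fineK.
have be0 i : 0 <= be i.
  by apply: fine_ge0; apply: integral_ge0 => y _; rewrite lee_fin powR_ge0.
have al0 i : 0 <= al i.
  by apply: fine_ge0; apply: integral_ge0 => y _; rewrite lee_fin mulr_ge0// powR_ge0.
have := a0E; rewrite !aE lee_fin => -[<-].
apply: (absorption L0 delC al0 be0) => i.
- by have := step i; rewrite !aE !bE -!EFinM -!EFinD lee_fin.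
- by have := bCa i; rewrite aE bE -EFinM lee_fin.
Qed.

Lemma reverse_holder_cell : (\int[mu]_(y in Q) (w y `^ (1 + del))%:E <=
  (8 * av w (cell k x0) `^ (1 + del) * side (cell k x0) ^+ d)%:E)%E.
Proof.
(* By [differentiation], [w y <= 4 * dmax n y] for some [n] at almost every [y] with [w y > 0].
   Since [del <= 1], the limit of [g n y] then dominates the power of [w y]. *)
pose g n y := (4 * (w y * dmax n y `^ del))%:E.
have mg n : measurable_fun Q (g n).
  by apply: measE; apply: measurable_funM.
have g0 n y : Q y -> (0 <= g n y)%E.
  by move=> _; rewrite lee_fin !mulr_ge0// powR_ge0.
have ndg y : Q y -> nondecreasing_seq (g ^~ y).
  move=> _; apply/nondecreasing_seqP => n.
  rewrite lee_fin ler_wpM2l// ler_wpM2l//; apply: ge0_ler_powR.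
  - exact: ltW.
  - by rewrite nnegrE dmax_ge0.
  - by rewrite nnegrE dmax_ge0.
  - by rewrite /= le_max lexx.
apply: (@le_trans _ _ (\int[mu]_(y in Q) limn (g ^~ y))%E).
  apply: ae_ge0_le_integral => //.
  - by move=> y _; rewrite lee_fin powR_ge0.
  - apply: measE; exact: measurableT_comp (measurable_powR _) lw.1.
  - move=> y Qy; apply: lime_ge; first exact/ereal_nondecreasing_is_cvgn/ndg.
    by apply: nearW => n; exact: g0.
  - apply: (emeasurable_fun_cvg g) => // y Qy.
    exact/ereal_nondecreasing_is_cvgn/ndg.
  apply: filterS (@differentiation _ _ D k x0 w lw) => y Dy Qy.
  rewrite (cvg_lim _ (ereal_nondecreasing_cvgn (ndg _ Qy)))//.
  have [wy|wy] := eqVneq (w y) 0.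
    apply: ereal_sup_ge; exists (g 0%N y) => //; rewrite wy powR0 ?g0//.
    by rewrite gt_eqF// ltr_wpDl.
  have wy0 : 0 < w y by rewrite lt0r wy w0.
  have [|n] := Dy Qy; first by rewrite normr_gt0.
  rewrite ger0_norm// => wn.
  apply: ereal_sup_ge; exists (g n y) => //.
  rewrite lee_fin powRD ?powRr1 ?(ltW wy0)//; last by rewrite wy implybT.
  rewrite mulrCA ler_wpM2l//.
  apply: (@le_trans _ _ ((4 * dmax n y) `^ del)).
    apply: ge0_ler_powR; rewrite ?nnegrE ?mulr_ge0 ?dmax_ge0 ?(ltW del0)//.
    by have := dmax_ge_av n y; lra.
  rewrite powRM ?dmax_ge0// ler_wpM2r ?powR_ge0//.
  apply: ler1_powR; first by rewrite ler1n.
  by case/andP: del01.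
rewrite monotone_convergence//.
apply: lime_le.
  apply: ereal_nondecreasing_is_cvgn => m n mn.
  by apply: ge0_le_integral => // y Qy; [exact: g0|exact: ndg].
apply: nearW => n; rewrite /g.
under eq_integral do rewrite EFinM.
rewrite ge0_integralZl_EFin//; last 2 first.
- by move=> y _; rewrite lee_fin mulr_ge0// powR_ge0.
- exact: measE.
apply: (@le_trans _ _ (4%:E * (2 * (x `^ (1 + del) * vol))%:E)%E).
  by apply: lee_wpmul2l; [rewrite lee_fin|exact: a_bound].
by rewrite -EFinM lee_fin /x /vol /=; lra.
Qed.

End ReverseHolderCell.

Section ReverseHolder.
Variable R : realType.
Variable d : nat.
Local Notation mu := (leb R d).

Lemma ae_exists (A : set (Rd R d)) (P : Rd R d -> Prop) : measurable A -> (0 < mu A)%E ->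
  {ae mu, forall x, P x} -> exists2 x, A x & P x.
Proof.
move=> mA A0 [N [mN N0 PN]]; apply: contrapT => nex.
have AN : A `<=` N by move=> x Ax; apply: PN => Px; apply: nex; exists x.
by move: A0; rewrite (subset_measure0 mA mN AN N0) ltxx.
Qed.

Lemma cube_nonempty (Q : cube R d) : is_cube Q -> exists x, cube_set Q x.
Proof.
move=> Q0; have [x Qx _] := @ae_exists _ (fun=> True) (measurable_cube Q)
  (leb_cube_gt0 Q0) (aeW _ (fun=> Logic.I)).
by exists x.
Qed.

Section LocalGrid.
Variable Q : cube R d.
Hypothesis Q0 : is_cube Q.

Let lh k := side Q * 2 ^ k.

Let lh_gt0 k : 0 < lh k. Proof. by rewrite mulr_gt0// exprz_gt0. Qed.

Let lhS k : lh (k + 1) = 2 * lh k.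
Proof. by rewrite /lh expfzDr ?pnatr_eq0// expr1z; ring. Qed.

Let loS (k : int) (i : 'I_d) : exists z : int, corner Q i - corner Q i = z%:~R * lh k.
Proof. by exists 0; rewrite subrr mul0r. Qed.

(** Halving and doubling from the fixed corner of [Q]: the estimate for cells thereby reaches an
    arbitrary cube. *)
Definition local_grid : grid R d := Grid lh_gt0 lhS loS.

Lemma local_cell x : cube_set Q x -> cell local_grid 0 x = Q.
Proof.
move=> Qx; have lh0 : lh 0 = side Q by rewrite /lh expr0z mulr1.
have Qq : qcube local_grid 0 [ffun=> 0] = Q.
  rewrite /qcube /= lh0; case: Q => c s /=; congr Cube; apply/funext => i.
  by rewrite ffunE mul0r addr0.
have /in_qcube e : cube_set (qcube local_grid 0 [ffun=> 0]) x by rewrite Qq.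
by rewrite /cell e Qq.
Qed.

End LocalGrid.

Lemma reverse_holder (w : Rd R d -> R) (C del : R) (Q : cube R d) :
  locint w -> (forall y, 0 <= w y) -> 0 <= C ->
  (forall P, is_cube P -> {ae mu, forall y, cube_set P y -> av w P <= C * w y}) ->
  0 < del <= 1 -> 2 ^+ d * del * C <= 2^-1 -> is_cube Q ->
  (\int[mu]_(y in cube_set Q) (w y `^ (1 + del))%:E <=
   (8 * av w Q `^ (1 + del) * side Q ^+ d)%:E)%E.
Proof.
move=> lw w0 C0 A1 d01 dC Q0; have [x Qx] := cube_nonempty Q0.
have := @reverse_holder_cell _ _ (local_grid Q0) 0 x w C del lw w0 C0 A1 d01 dC.
by rewrite local_cell.
Qed.

End ReverseHolder.

(** * Sparse families: local integrability and decay along towers *)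

Section SparseFamilies.
Variable R : realType.
Variable d : nat.
Hypothesis d_gt0 : (0 < d)%N.
Local Notation T := (Rd R d).
Local Notation mu := (leb R d).
Implicit Types (S : set (cube R d)) (f : T -> R).

Lemma sparse1 (Q : cube R d) : is_cube Q -> sparse [set Q].
Proof.
move=> Q0; split => [_ ->//|]; exists (@cube_set R d); split => [_ ->|_ _ -> ->//].
split; first exact: measurable_cube.
split => //; rewrite leb_cube// -EFinM lee_fin ler_piMl ?exprn_ge0 ?ltW//.
by lra.
Qed.

Lemma sparse_op_term S f Q x : sparse S -> S Q -> cube_set Q x ->
  (avg Q f <= sparse_op S f x)%E.
Proof.
move=> [Sc _] SQ Qx; apply: esum_ge; exists [set Q].
  by split => [|_ ->]; [exact: finite_set1|].
rewrite fsbig_set1 indicE mem_set//= mule1//.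
Qed.

Lemma sparse_op_ge0 S f x : sparse S -> (0 <= sparse_op S f x)%E.
Proof.
move=> [Sc _]; apply: esum_ge0 => Q SQ.
by rewrite mule_ge0 ?avg_ge0//; exact: Sc.
Qed.

Variable f : T -> R.
Hypothesis mf : measurable_fun setT f.
Hypothesis f_fin : forall S, sparse S -> {ae mu, forall x, (sparse_op S f x < +oo)%E}.

(** A single cube is a sparse family, and its operator is finite at a point of the cube only if the
    average is finite. *)
Lemma sparse_op_fin_locint : locint f.
Proof.
split => // Q Q0.
have [x Qx] := ae_exists (measurable_cube Q) (leb_cube_gt0 Q0) (f_fin (sparse1 Q0)).
move=> /(le_lt_trans (sparse_op_term _ (sparse1 Q0) erefl Qx)) avf.
rewrite integral_avg// lte_mul_pinfty ?avg_ge0//.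
- by rewrite ge0_fin_numE ?avg_ge0.
- exact: ltry.
Qed.

Let lf := sparse_op_fin_locint.
Variable D : grid R d.
Local Notation cell := (cell D).

Let two_d : 2 <= 2 ^+ d :> R.
Proof. by rewrite -natrX ler_nat -{1}(expn1 2) leq_exp2l. Qed.

Let ghlt (l : int) (m n : nat) : (m < n)%N -> gh D (l + m%:Z) < gh D (l + n%:Z).
Proof.
elim: n => // n IH; rewrite ltnS leq_eqVlt intS [1 + _]addrC addrA ghS => /predU1P[->|/IH].
  by have := gh_gt0 D (l + n%:Z); lra.
by have := gh_gt0 D (l + n%:Z); lra.
Qed.

Let tower_inj (l : int) (x : T) (m n : nat) :
  cell (l + m%:Z) x = cell (l + n%:Z) x -> m = n.
Proof.
move=> /(congr1 (@side R d)) /= e; case: (ltngtP m n) => // /(ghlt l).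
  by rewrite e ltxx.
by rewrite e ltxx.
Qed.

(** Removing from each cube the next smaller cell around [x] leaves the fraction [1 - 2^-d], at
    least one half because [d > 0]. *)
Lemma sparse_tower (l : int) (x : T) : sparse (range (fun n : nat => cell (l + n%:Z) x)).
Proof.
split => [_ [n _ <-]|]; first exact: is_cube_qcube.
pose E n := cube_set (cell (l + n%:Z) x) `\` cube_set (cell (l + n%:Z - 1) x).
pose q n := cell (l + n%:Z) x.
have qinj := @tower_inj l x.
(* Sparseness indexes the parts by cubes, not by [n]; injectivity of [q] makes this union a single
   [E n]. *)
exists (fun Q => \bigcup_(n in [set n | q n = Q]) E n).
have EE n : \bigcup_(m in [set m | q m = q n]) E m = E n.
  by apply/seteqP; split => [y [m /= /qinj ->]//|y Ey]; exists n.
split => [_ [n _ <-]|_ _ [m _ <-] [n _ <-] mn]; rewrite !EE.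
- have mE : measurable (E n) by apply: measurableD; exact: measurable_cube.
  split => //; split; first by move=> y [].
  have : mu (cube_set (cell (l + n%:Z) x)) =
      (mu (E n) + mu (cube_set (cell (l + n%:Z - 1) x)))%E.
    have sub : cube_set (cell (l + n%:Z - 1) x) `<=` cube_set (cell (l + n%:Z) x).
      by apply: sub_cell; rewrite gerBl.
    by rewrite -[X in (_ + mu X)%E](setIidr sub); apply: measureDI;
      exact: measurable_cube.
  rewrite !leb_cube; try exact: is_cube_qcube.
  rewrite /q /=; have := ghS D (l + n%:Z - 1); rewrite subrK => ->.
  have h0 : 0 < gh D (l + n%:Z - 1) ^+ d by rewrite exprn_gt0// gh_gt0.
  move: h0; rewrite exprMn; set h := gh _ _ ^+ d => h0.
  case: (mu (E n)) => [r||] //=.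
  rewrite -EFinD => -[e]; rewrite -EFinM lee_fin.
  have : 2 * h <= 2 ^+ d * h by rewrite ler_pM2r.
  by lra.
- have lem (i j : nat) : (i < j)%N -> E i `&` E j = set0.
    move=> ij; apply/seteqP; split => // y [[yi _] [_ yj]]; apply: yj.
    have : cube_set (cell (l + i%:Z) x) y by [].
    by apply: sub_cell; rewrite -addrA lerD2l lerBrDr -PoszD lez_nat addn1.
  case: (ltngtP m n) => [/lem//|/lem|e]; first by rewrite setIC.
  by case: mn; rewrite e.
Qed.

(** Otherwise infinitely many cubes of the tower have average at least [lam]. All contain
    [cell l x], so the sparse operator of the tower would be infinite on a set of positive measure.
    This decay makes maximal cells exist. *)
Lemma av_tower_small (l : int) (x : T) (lam : R) : 0 < lam ->
  exists N : nat, forall n : nat, (N <= n)%N -> av f (cell (l + n%:Z) x) < lam.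
Proof.
move=> lam0; apply: contrapT => /forallNP nN.
have big N : exists2 n : nat, (N <= n)%N & lam <= av f (cell (l + n%:Z) x).
  have /existsNP[n /not_implyP[Nn /negP]] := nN N.
  by rewrite -leNgt; exists n.
pose q n := cell (l + n%:Z) x.
have qinj := @tower_inj l x.
have sp := sparse_tower l x.
have [y yl] := ae_exists (measurable_cube (cell l x))
  (leb_cube_gt0 (is_cube_qcube _ _ _)) (f_fin sp).
have partial M : ((\sum_(0 <= n < M) av f (q n))%:E <= sparse_op (range q) f y)%E.
  apply: esum_ge; exists (q @` `I_M).
    split; first exact/finite_image/finite_II.
    by move=> _ [n _ <-]; exists n.
  rewrite fsbig_image; last by move=> m n _ _ /qinj.
  rewrite -fsbig_ord big_mkord -sumEFin; apply: lee_sum => n _.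
  rewrite -avE//; last exact: is_cube_qcube.
  rewrite indicE mem_set ?mule1//.
  by apply: sub_cell yl; rewrite lerDl.
have grow j : exists M, j%:R * lam <= \sum_(0 <= n < M) av f (q n).
  elim: j => [|j [M IH]]; first by exists 0%N; rewrite mul0r big_nil.
  have [n Mn ln] := big M; exists n.+1.
  rewrite big_nat_recr//= -natr1 mulrDl mul1r lerD//.
  apply: (le_trans IH); rewrite [leRHS](big_cat_nat (leq0n M) Mn)/= lerDl.
  by apply: sumr_ge0 => i _; apply: av_ge0; exact: is_cube_qcube.
have s0 := @sparse_op_ge0 _ f y sp.
rewrite -ge0_fin_numE// => yfin.
have [M] := grow (Num.bound (fine (sparse_op (range q) f y) / lam)).
have := partial M; rewrite -(fineK yfin) lee_fin => /[swap] /le_trans /[apply].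
rewrite -ler_pdivlMr//.
have := archi_boundP (divr_ge0 (fine_ge0 s0) (ltW lam0)).
by move=> /lt_le_trans /[apply]; rewrite ltxx.
Qed.

End SparseFamilies.

(** * Sparse domination of dyadic averages *)

Lemma ltz_addnS (k l : int) : k < l -> exists n : nat, l = k + n.+1%:Z.
Proof.
move=> kl; exists (absz (l - (k + 1))%R).
by rewrite intS gez0_abs ?subr_ge0 ?lezD1//; ring.
Qed.

Section PrincipalCubes.
Variable R : realType.
Variable d : nat.
Hypothesis d_gt0 : (0 < d)%N.
Local Notation T := (Rd R d).
Local Notation mu := (leb R d).
Variable f : T -> R.
Hypothesis mf : measurable_fun setT f.
Hypothesis f_fin : forall S, sparse S -> {ae mu, forall x, (sparse_op S f x < +oo)%E}.
Let lf := sparse_op_fin_locint mf f_fin.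
Variable D : grid R d.
Local Notation cell := (cell D).
Local Notation idx := (idx D).

Variables (a : R) (lev : R -> int).
Hypothesis aE : a = 2 * 2 ^+ d.
Hypothesis lev_le : forall v, 0 < v -> a ^ lev v <= v.
Hypothesis lev_gt : forall v, 0 < v -> v < a ^ (lev v + 1).

Let a_gt1 : 1 < a.
Proof. by rewrite aE -exprS exprn_egt1// ltr1n. Qed.

Let a_gt0 : 0 < a. Proof. exact: lt_trans a_gt1. Qed.

Let aS j : a ^ (j + 1) = a * a ^ j.
Proof. by rewrite expfzDr ?gt_eqF// expr1z mulrC. Qed.

Let pow_gt0 j : 0 < a ^ j. Proof. exact: exprz_gt0. Qed.

Let pow_le j : a ^ j <= a ^ (j + 1).
Proof. by rewrite aS ler_peMl ?ltW. Qed.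

Let half_bound c p z s : 0 < c -> 0 < p -> 2 * c * p * z <= c * p * s -> z <= 2^-1 * s :> R.
Proof.
move=> c0 p0; have -> : 2 * c * p * z = c * p * (2 * z) by ring.
by rewrite ler_pM2l ?mulr_gt0//; lra.
Qed.

Let half_rest s e z : s <= e + z -> z <= 2^-1 * s -> 2^-1 * s <= e :> R.
Proof. by lra. Qed.

(** The maximal cells on which the average reaches a power of [a]. In [a = 2 * 2 ^+ d] the factor
    [2 ^+ d] pays for passing to a parent, and the factor 2 leaves half of the cube for its part. *)
Definition principal : set (cube R d) := [set Q | exists k x, [/\ Q = cell k x,
  0 < av f Q & forall n : nat, av f (cell (k + n.+1%:Z) x) < a ^ lev (av f Q)]].

(** No cell around such a point reaches the next level. All generations are included, so that two
    parts can be compared whichever cube is larger. *)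
Definition principal_part (Q : cube R d) : set T := [set y | cube_set Q y /\
  forall l : int, av f (cell l y) < a ^ (lev (av f Q) + 1)].

Lemma measurable_principal_part Q : measurable (principal_part Q).
Proof.
rewrite (_ : principal_part Q = cube_set Q `\`
    \bigcup_(l : int) [set y | a ^ (lev (av f Q) + 1) <= av f (cell l y)]).
  apply: measurableD; first exact: measurable_cube.
  apply: countable_bigcupT_measurable => // l.
  by apply: (@measurable_genset _ _ D l) => y z yz; rewrite /mkset (cell_eq yz).
apply/seteqP; split => [y [Qy ly]|y [Qy ny]]; split => //.
  by move=> [l _ /=]; rewrite leNgt ly.
by move=> l; rewrite ltNge; apply/negP => h; apply: ny; exists l.
Qed.

(** The parent has average below [a ^ j], hence [Q] has average at most [2^d a^j]. By the weak-type
    inequality at height [a ^ (j + 1)] the rest of [Q] has at most the fraction [2^d / a = 1 / 2] of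
    its measure. *)
Lemma principal_part_large Q : principal Q ->
  ((2^-1)%:E * mu (cube_set Q) <= mu (principal_part Q))%E.
Proof.
move=> [k [x [QE v0 anc]]]; set j := lev _ in anc.
pose Z := [set y | idx k y = idx k x /\
  exists n : nat, a ^ (j + 1) <= av f (cell (k - n%:Z) y)].
have mZ : measurable Z.
  rewrite (_ : Z = cube_set Q `&`
      \bigcup_(n : nat) [set y | a ^ (j + 1) <= av f (cell (k - n%:Z) y)]).
    apply: measurableI; first exact: measurable_cube.
    apply: bigcupT_measurable => n.
    by apply: (@measurable_genset _ _ D (k - n%:Z)) => y z yz;
      rewrite /mkset (cell_eq yz).
  rewrite QE; apply/seteqP; split => [y [yx [n yn]]|y [/in_cell yx [n _ yn]]].
    by split; [exact/in_cell|exists n].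
  by split => //; exists n.
have mE := measurable_principal_part Q.
have cov : cube_set Q `<=` principal_part Q `|` Z.
  move=> y Qy; have [Zy|nZ] := pselect (Z y); [by right|left; split => // l].
  rewrite ltNge; apply/negP => lav.
  have yx : idx k y = idx k x by move: Qy; rewrite QE => /in_cell.
  have [lk|kl] := leP l k.
    apply: nZ; split => //; exists `|k - l|%N.
    by rewrite gez0_abs ?subr_ge0// opprB subrKC.
  have [n ln] : exists n : nat, l = k + n.+1%:Z by exact: ltz_addnS.
  have := anc n; rewrite -ln => h.
  have : av f (cell l y) = av f (cell l x).
    by rewrite (@cell_eq _ _ D l y x)//; apply: idx_le yx; exact: ltW.
  move=> e; have : a ^ (j + 1) < a ^ j by apply: le_lt_trans h; rewrite -e.
  by rewrite ltNge pow_le.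
have Q0 : is_cube Q by rewrite QE; exact: is_cube_qcube.
have wk : ((a ^ (j + 1))%:E * mu Z <= (av f Q * side Q ^+ d)%:E)%E.
  by rewrite -integral_av// {1}QE; apply: weak_type => //; exact: ltW.
have avQ : av f Q <= 2 ^+ d * a ^ j.
  rewrite {1}QE; apply: le_trans (av_parent D k x lf) _.
  by rewrite ler_wpM2l// ltW//; exact: (anc 0%N).
have QEZ : (mu (cube_set Q) <= mu (principal_part Q) + mu Z)%E.
  apply: (@le_trans _ _ (mu (principal_part Q `|` Z))).
    apply: le_measure; rewrite ?inE//; first exact: measurable_cube.
    exact: measurableU.
  exact: measureU2.
rewrite leb_cube// in QEZ *.
have s0 : 0 < side Q ^+ d by rewrite exprn_gt0.
set s := side Q ^+ d in s0 wk QEZ *.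
have : (0 <= mu Z)%E by [].
have : (0 <= mu (principal_part Q))%E by [].
move: QEZ wk; case: (mu Z) => [z| |] //=; last first.
  by rewrite gt0_muley// lte_fin.
case: (mu (principal_part Q)) => [e| |] //=; last by move=> *; rewrite leey.
rewrite -EFinD -!EFinM !lee_fin => sez wk _ _.
have zs : z <= 2^-1 * s.
  have p0 := pow_gt0 j.
  apply: (@half_bound (2 ^+ d) (a ^ j)) => //.
  by rewrite -aE -aS; apply: (le_trans wk); rewrite ler_pM2r.
exact: half_rest sez zs.
Qed.

(** A common point forces equal levels, as neither average may exceed the level of the other. Of two
    nested cubes of equal level the smaller one would violate its condition on ancestors. *)
Lemma principal_part_disjoint Q Q' : principal Q -> principal Q' -> Q <> Q' ->
  principal_part Q `&` principal_part Q' = set0.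
Proof.
move=> pQ pQ' QQ'; apply/seteqP; split => // y [yQ yQ']; apply: QQ'.
have lev_mono P P' : principal P -> principal_part P y -> principal_part P' y ->
    lev (av f P) <= lev (av f P').
  move=> [k [x [PE v0 _]]] [Py _] [_ /(_ k)].
  have Py' := Py; rewrite PE in Py' => h.
  have : a ^ lev (av f P) < a ^ (lev (av f P') + 1).
    apply: (le_lt_trans (lev_le v0)); rewrite {1}PE.
    by move/in_cell : Py' => /cell_eq <-.
  by rewrite ltr_eXz2l// ltzD1.
have eqlev : lev (av f Q) = lev (av f Q').
  by apply/eqP; rewrite eq_le !lev_mono.
have strict P P' k k' x x' : lev (av f P) = lev (av f P') -> cube_set P y ->
    cube_set P' y -> P = cell k x -> P' = cell k' x' -> 0 < av f P' ->
    (forall n : nat, av f (cell (k + n.+1%:Z) x) < a ^ lev (av f P)) -> ~ (k < k').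
  move=> el Py P'y PE P'E v0 anc kk'.
  have [n kn] : exists n : nat, k' = k + n.+1%:Z by exact: ltz_addnS.
  have := anc n; rewrite -kn el ltNge; apply/negP/negPn.
  apply: le_trans (lev_le v0) _; rewrite {1}P'E.
  rewrite (_ : cell k' x' = cell k' x)//; apply: cell_eq.
  move: Py P'y; rewrite PE P'E => /in_cell yx /in_cell <-.
  by apply: idx_le yx; exact: ltW.
have [k [x [QE v0 anc]]] := pQ; have [k' [x' [QE' v0' anc']]] := pQ'.
have Qy := yQ.1; have Q'y := yQ'.1.
case: (ltgtP k k') => [kk|kk|kk].
- by case: (strict _ _ _ _ _ _ eqlev Qy Q'y QE QE' v0' anc kk).
- by case: (strict _ _ _ _ _ _ (esym eqlev) Q'y Qy QE' QE v0 anc' kk).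
- rewrite QE QE' kk; rewrite QE in Qy; rewrite QE' in Q'y.
  move/in_cell : Qy; move/in_cell : Q'y; rewrite kk => e1 e2.
  by apply: cell_eq; rewrite -e1 -e2.
Qed.

Lemma sparse_principal : sparse principal.
Proof.
split => [Q [k [x [-> _ _]]]|]; first exact: is_cube_qcube.
exists principal_part; split => [Q pQ|Q Q']; last exact: principal_part_disjoint.
split; first exact: measurable_principal_part.
by split; [move=> y []|exact: principal_part_large].
Qed.

(** With [j] the level of the cell, its largest ancestor of average at least [a ^ j] exists by
    [av_tower_small] and is principal, though its own level may exceed [j]. Rounding to levels costs
    the factor [a]. *)
Lemma av_le_sparse_op k y : ((av f (cell k y))%:E <= a%:E * sparse_op principal f y)%E.
Proof.
have s0 := @sparse_op_ge0 _ _ _ f y sparse_principal.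
have := av_ge0 f (is_cube_qcube D k (idx k y)).
rewrite -/(cell k y) le_eqVlt => /predU1P[<-|v0].
  by rewrite mule_ge0// lee_fin ltW.
set v := av _ _ in v0 *; set j := lev v.
have ex : exists n : nat, a ^ j <= av f (cell (k + n%:Z) y).
  by exists 0%N; rewrite addr0; exact: lev_le.
have [N hN] := av_tower_small d_gt0 mf f_fin D k y (pow_gt0 j).
have ub (n : nat) : a ^ j <= av f (cell (k + n%:Z) y) -> (n <= N)%N.
  by move=> h; rewrite leqNgt; apply/negP => /ltnW /hN; rewrite ltNge h.
have [n nj nmax] := ex_maxnP ex ub.
set Q := cell (k + n%:Z) y in nj.
have v0' : 0 < av f Q by apply: lt_le_trans nj.
have jlev : j <= lev (av f Q).
  have : a ^ j < a ^ (lev (av f Q) + 1) by apply: le_lt_trans nj (lev_gt v0').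
  by rewrite ltr_eXz2l// ltzD1.
have pQ : principal Q.
  exists (k + n%:Z), y; split => // m; apply: (@lt_le_trans _ _ (a ^ j)).
    rewrite ltNge; apply/negP; rewrite -addrA -PoszD => /nmax.
    by rewrite addnS ltnNge leq_addr.
  by rewrite ler_eXz2l.
have := sparse_op_term f sparse_principal pQ (cell_self D _ _).
rewrite avE//; last exact: is_cube_qcube.
move=> h; apply: (@le_trans _ _ (a%:E * (av f Q)%:E)%E).
  rewrite -EFinM lee_fin; apply: (le_trans (ltW (lev_gt v0))).
  by rewrite aS ler_pM2l.
by apply: lee_wpmul2l => //; rewrite lee_fin ltW.
Qed.

End PrincipalCubes.

Lemma sparse_domination (R : realType) (d : nat) (f : Rd R d -> R) (D : grid R d) :
  (0 < d)%N -> measurable_fun setT f ->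
  (forall S, sparse S -> {ae leb R d, forall x, (sparse_op S f x < +oo)%E}) ->
  exists2 S, sparse S & forall k y,
    ((av f (cell D k y))%:E <= (2 * 2 ^+ d)%:E * sparse_op S f y)%E.
Proof.
move=> d0 mf f_fin; have a1 : 1 < 2 * 2 ^+ d :> R.
  by rewrite -exprS exprn_egt1// ltr1n.
have [lev [lev_le lev_gt]] : exists lev : R -> int,
    (forall v, 0 < v -> (2 * 2 ^+ d) ^ lev v <= v) /\
    (forall v, 0 < v -> v < (2 * 2 ^+ d) ^ (lev v + 1)).
  exists (fun v => Num.floor (ln v / ln (2 * 2 ^+ d : R))).
  by split => v v0; have /andP[] := exprz_floor_ln a1 v0.
exists (principal f D (2 * 2 ^+ d) lev).
  exact: (sparse_principal mf f_fin D erefl lev_le).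
exact: (av_le_sparse_op d0 mf f_fin D erefl lev_le lev_gt).
Qed.

(** * Majorants for the averages over all cubes *)

Section ThirdGrids.
Variable R : realType.

Lemma exprzN2 (k : int) : exists b : bool, (-2 : R) ^ k = (-1) ^+ b * 2 ^ k.
Proof.
case: k => n; [exists (odd n)|exists (odd n.+1)]; rewrite signr_odd.
  exact: exprNn.
rewrite [LHS](_ : _ = ((-2) ^+ n.+1)^-1)// [2 ^ _](_ : _ = (2 ^+ n.+1)^-1)//.
by rewrite exprNn invfM -signr_odd invr_sign.
Qed.

(* An interval of length below h / 3 cannot meet both h Z and h (Z + 1/3)
   (or h (Z - 1/3)). *)
Lemma third_interval (c s h : R) (b : bool) : 0 < s -> 3 * s < h ->
  exists p : bool * int, forall u, c <= u < c + s ->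
    let o := if p.1 then (-1) ^+ b * h / 3 else 0 in
    o + p.2%:~R * h <= u < o + p.2%:~R * h + h.
Proof.
move=> s0 sh; have h0 : 0 < h by lra.
have := floor_itv ((c + s) / h); set m := Num.floor _.
rewrite ler_pdivlMr// ltr_pdivrMr// intrD mulr1z mulrDl mul1r => /andP[m1 m2].
have [mc|cm] := leP (m%:~R * h) c.
  by exists (false, m) => u /andP[u1 u2] /=; apply/andP; split; lra.
(* The point [m h] lies in the interval, and the chosen shifted cell extends at least [h / 3] to
   either side of it. *)
exists (true, if b then m else m - 1) => u /andP[u1 u2] /=.
case: b => /=; rewrite ?expr0 ?expr1 ?intrB ?mulr1z; apply/andP; split; lra.
Qed.

Variable d : nat.
Variable t : {ffun 'I_d -> bool}.

Let th (k : int) : R := 2 ^ k.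
(** The sign alternates so that successive origins differ by [(-2) ^ k], an integer multiple of the
    side; with shifts [2 ^ k / 3] the grids would not nest. *)
Let to (k : int) (i : 'I_d) : R := if t i then (-2) ^ k / 3 else 0.

Let th_gt0 k : 0 < th k. Proof. exact: exprz_gt0. Qed.

Let thS k : th (k + 1) = 2 * th k.
Proof. by rewrite /th expfzDr ?pnatr_eq0// expr1z mulrC. Qed.

Let toS k i : exists z : int, to (k + 1) i - to k i = z%:~R * th k.
Proof.
rewrite /to; case: (t i); last by exists 0; rewrite subrr mul0r.
have [b e] := exprzN2 k; exists (- (-1) ^+ b).
rewrite expfzDr ?oppr_eq0 ?pnatr_eq0// expr1z e /th.
rewrite rmorphN rmorphXn/= rmorphN1; set x := _ ^ k.
by field.
Qed.

Definition third_grid : grid R d := Grid th_gt0 thS toS.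

End ThirdGrids.

Section ThirdCover.
Variable R : realType.
Variable d : nat.

Lemma third_cover (Q : cube R d) : is_cube Q -> exists t k m,
  cube_set Q `<=` cube_set (qcube (third_grid R t) k m) /\
  side (qcube (third_grid R t) k m) <= 6 * side Q.
Proof.
move=> Q0; have s6 : 0 < 6 * side Q by rewrite mulr_gt0.
(* The side must exceed [3 * side Q] for [third_interval], and a power of two doing so is found
   below [6 * side Q]. *)
have [k /andP[k1 k2]] : exists k : int, 2 ^ k <= 6 * side Q < 2 ^ (k + 1).
  by eexists; apply: exprz_floor_ln s6; rewrite ltr1n.
have [b eb] := exprzN2 R k.
have sh : 3 * side Q < 2 ^ k.
  by move: k2; rewrite expfzDr ?pnatr_eq0// expr1z; lra.
have /choice[p hp] := fun i => third_interval (corner Q i) b Q0 sh.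
exists [ffun i => (p i).1], k, [ffun i => (p i).2]; split => // y Qy i.
have := hp i (coord y i) (Qy i).
by rewrite /= !ffunE eb.
Qed.

End ThirdCover.

Section Space.
Variable R : realType.
Variable d : nat.
Hypothesis d_gt0 : (0 < d)%N.
Local Notation T := (Rd R d).
Local Notation mu := (leb R d).
Variables (X : set (T -> R)) (nX : (T -> R) -> R) (K C0 : R).
Hypothesis qX : qBFS X nX.
Hypothesis K_ge1 : 1 <= K.
Hypothesis KX : quasi_triangle X nX K.
Hypothesis spX : Asparse_with X nX C0.

Lemma X_measurable f : X f -> measurable_fun setT f.
Proof. by case: qX => + _; apply. Qed.

Lemma X_zero : X (fun=> 0).
Proof. by case: qX => _ [+ _]. Qed.

Lemma X_add f g : X f -> X g -> X (f \+ g).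
Proof. by case: qX => _ [_ [+ _]]; apply. Qed.

Lemma X_scale c f : X f -> X (fun x => c * f x).
Proof. by case: qX => _ [_ [_ [+ _]]]; apply. Qed.

Lemma nX_ge0 f : X f -> 0 <= nX f.
Proof. by case: qX => _ [_ [_ [_ [+ _]]]]; apply. Qed.

Lemma nX_eq0 f : X f -> nX f = 0 <-> {ae mu, forall x, f x = 0}.
Proof. by case: qX => _ [_ [_ [_ [_ [+ _]]]]]; apply. Qed.

Lemma nX_scale c f : X f -> nX (fun x => c * f x) = `|c| * nX f.
Proof. by case: qX => _ [_ [_ [_ [_ [_ [+ _]]]]]]; apply. Qed.

Lemma X_complete (u : nat -> T -> R) : (forall n, X (u n)) ->
  (forall e, 0 < e -> exists N, forall m n, (N <= m)%N -> (N <= n)%N ->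
    nX (u n \- u m) < e) ->
  exists2 f, X f & forall e, 0 < e -> exists N, forall n, (N <= n)%N ->
    nX (u n \- f) < e.
Proof. by case: qX => _ [_ [_ [_ [_ [_ [_ [_ [+ _]]]]]]]]; apply. Qed.

Lemma X_ideal f (g : T -> R) : X f -> measurable_fun setT g ->
  {ae mu, forall x, `|g x| <= `|f x|} -> X g /\ nX g <= nX f.
Proof. by case: qX => _ [_ [_ [_ [_ [_ [_ [_ [_ [+ _]]]]]]]]]; apply. Qed.

Lemma X_sparse_fin f S : X f -> sparse S ->
  {ae mu, forall x, (sparse_op S f x < +oo)%E}.
Proof. by move=> Xf spS; have [_ /(_ S f spS Xf)[]] := spX. Qed.

Lemma X_sparse_op f S : X f -> sparse S ->
  X (fun x => fine (sparse_op S f x)) /\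
  nX (fun x => fine (sparse_op S f x)) <= C0 * nX f.
Proof. by move=> Xf spS; have [_ /(_ S f spS Xf)[]] := spX. Qed.

Lemma X_locint f : X f -> locint f.
Proof.
by move=> Xf; apply: sparse_op_fin_locint => [|S]; [exact: X_measurable|exact: X_sparse_fin].
Qed.

Lemma nX_zero : nX (fun=> 0) = 0.
Proof. by apply/nX_eq0; [exact: X_zero|exact: aeW]. Qed.

Lemma X_sum (I : Type) (s : seq I) (u : I -> T -> R) (c : R) : 0 <= c ->
  (forall i, X (u i) /\ nX (u i) <= c) ->
  X (fun x => \sum_(i <- s) u i x) /\
  nX (fun x => \sum_(i <- s) u i x) <= (2 * K) ^+ size s * c.
Proof.
move=> c0 uc; elim: s => [|i s [Xs ns]].
  rewrite (_ : (fun _ => _) = fun=> 0); last by apply/funext => x; rewrite big_nil.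
  by rewrite nX_zero mul1r; split => //; exact: X_zero.
rewrite (_ : (fun _ => _) = u i \+ (fun x => \sum_(j <- s) u j x)); last first.
  by apply/funext => x; rewrite big_cons.
have [Xi ni] := uc i; split; first exact: X_add.
apply: le_trans (KX Xi Xs) _.
have K0 : 0 <= K by exact: le_trans K_ge1.
have K2 : 1 <= 2 * K by move: K_ge1; lra.
have p1 : 1 <= (2 * K) ^+ size s by exact: exprn_ege1.
have p2 : c <= (2 * K) ^+ size s * c by rewrite ler_peMl.
rewrite /= exprS -mulrA; set p := _ * c in ns p2 *.
have : K * (nX (u i) + nX (fun x => \sum_(j <- s) u j x)) <= K * (p + p).
  by rewrite ler_wpM2l// lerD// (le_trans ni).
by move=> /le_trans; apply; rewrite mulrDr -mulrA mulr2n mulrDl mul1r.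
Qed.

Lemma X_majorant : exists2 C1 : R, 0 < C1 & forall f, X f -> exists F, [/\ X F,
  forall x, 0 <= F x, nX F <= C1 * nX f &
  forall Q, is_cube Q -> {ae mu, forall y, cube_set Q y -> av f Q <= F y}].
Proof.
(* [6 ^+ d] pays for enlarging a cube to a grid cell, [2 * 2 ^+ d] for sparse domination. *)
pose a : R := 6 ^+ d * (2 * 2 ^+ d).
have a0 : 0 < a by rewrite !mulr_gt0// exprn_gt0.
pose N := (2 * K) ^+ size (index_enum {ffun 'I_d -> bool}).
have C00 : 0 <= C0 by case: spX.
have N0 : 0 <= N by rewrite exprn_ge0// mulr_ge0// (le_trans _ K_ge1).
exists (a * (N * C0) + 1); first by rewrite ltr_wpDl// !mulr_ge0// ltW.
move=> f Xf; have lf := X_locint Xf.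
have /choice[S hS] : forall t : {ffun 'I_d -> bool}, exists S : set (cube R d),
    sparse S /\ forall k y, ((av f (cell (third_grid R t) k y))%:E <=
      (2 * 2 ^+ d)%:E * sparse_op S f y)%E.
  move=> t; have [S ? ?] := @sparse_domination R d f (third_grid R t) d_gt0
    (X_measurable Xf) (fun S => @X_sparse_fin f S Xf).
  by exists S.
pose u t y := fine (sparse_op (S t) f y).
have u0 t y : 0 <= u t y by apply: fine_ge0; apply: sparse_op_ge0; case: (hS t).
have [XF nF] : X (fun x => \sum_t u t x) /\ nX (fun x => \sum_t u t x) <= N * (C0 * nX f).
  apply: X_sum; first by rewrite mulr_ge0// nX_ge0.
  by move=> t; apply: X_sparse_op => //; case: (hS t).
exists (fun x => a * \sum_t u t x); split.
- exact: X_scale.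
- by move=> x; apply: mulr_ge0; [exact: ltW|exact: sumr_ge0].
- rewrite nX_scale// gtr0_norm// mulrDl mul1r ler_wpDr ?nX_ge0//.
  rewrite -mulrA -[N * C0 * _]mulrA; apply: ler_wpM2l => //; exact: ltW.
move=> Q Q0; have [t [k [m [QP sP]]]] := third_cover Q0.
have [spS domS] := hS t.
(* Where the sparse operator is infinite, [fine] would give 0 and the bound could fail. *)
apply: filterS (X_sparse_fin Xf spS) => y yfin Qy.
have /in_qcube ym := QP _ Qy.
set P := qcube _ k m in QP sP.
have PE : P = cell (third_grid R t) k y by rewrite /cell ym.
have P0 : is_cube P by exact: is_cube_qcube.
have s0 : 0 < side Q ^+ d by rewrite exprn_gt0.
have QavP : av f Q <= 6 ^+ d * av f P.
  rewrite -(ler_pM2r s0); apply: le_trans (av_sub lf Q0 P0 QP) _.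
  rewrite mulrAC mulrC -exprMn ler_wpM2r ?av_ge0//.
  by apply: lerXn2r => //; rewrite nnegrE ltW// mulr_gt0.
have avP : av f P <= 2 * 2 ^+ d * u t y.
  rewrite -lee_fin PE; apply: le_trans (domS k y) _.
  by rewrite [leRHS]EFinM /u fineK// ge0_fin_numE//; exact: sparse_op_ge0.
have ut : u t y <= \sum_t0 u t0 y.
  by rewrite (bigD1 t)//= lerDl sumr_ge0.
apply: (le_trans QavP); rewrite /a -mulrA ler_wpM2l ?exprn_ge0//.
by apply: (le_trans avP); rewrite ler_wpM2l.
Qed.

End Space.

(** * Rubio de Francia's algorithm *)

Section RubioDeFrancia.
Variable R : realType.
Variable d : nat.
Hypothesis d_gt0 : (0 < d)%N.
Local Notation T := (Rd R d).
Local Notation mu := (leb R d).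
Variables (X : set (T -> R)) (nX : (T -> R) -> R) (K C0 : R).
Hypothesis qX : qBFS X nX.
Hypothesis K_ge1 : 1 <= K.
Hypothesis KX : quasi_triangle X nX K.
Hypothesis spX : Asparse_with X nX C0.

Let K_gt0 : 0 < K. Proof. exact: lt_le_trans K_ge1. Qed.

Lemma X_opp f : X f -> X (\- f) /\ nX (\- f) = nX f.
Proof.
move=> Xf; rewrite (_ : \- f = fun x => -1 * f x); last first.
  by apply/funext => x; rewrite mulN1r.
by rewrite (nX_scale qX)// normrN1 mul1r; split => //; exact: (X_scale qX).
Qed.

Lemma X_sub f g : X f -> X g -> X (f \- g).
Proof. by move=> Xf Xg; apply: (X_add qX) => //; case: (X_opp Xg). Qed.

Section Series.
Variables (v : nat -> T -> R) (G : R).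
Hypothesis G_ge0 : 0 <= G.
Hypothesis Xv : forall n, X (v n).
Hypothesis v_ge0 : forall n x, 0 <= v n x.
Hypothesis nv : forall n, nX (v n) <= (2 * K)^-1 ^+ n * G.

Let q : R := (2 * K)^-1.
Let q_gt0 : 0 < q. Proof. by rewrite invr_gt0 mulr_gt0. Qed.
Let qK : 2 * K * q = 1. Proof. by rewrite divff// gt_eqF// mulr_gt0. Qed.

Let u n x := \sum_(i < n) v i x.

(** Peeling off the first term costs a factor [K] at each stage; since [2 * K * q = 1] the bound
    reproduces itself, uniformly in [n]. *)
Let tail n m : X (fun x => \sum_(i < n) v (m + i)%N x) /\
  nX (fun x => \sum_(i < n) v (m + i)%N x) <= 2 * K * q ^+ m * G.
Proof.
elim: n m => [|n IH] m.
  rewrite (_ : (fun _ => _) = fun=> 0); last by apply/funext => x; rewrite big_ord0.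
  rewrite (nX_zero qX); split; first exact: (X_zero qX).
  by rewrite !mulr_ge0// ?exprn_ge0// ltW.
have [Xt nt] := IH m.+1.
rewrite (_ : (fun _ => _) = v m \+ (fun x => \sum_(i < n) v (m.+1 + i)%N x)); last first.
  apply/funext => x; rewrite big_ord_recl addn0 /=; congr (_ + _).
  by apply: eq_bigr => i _; rewrite /bump /= add1n addSnnS.
split; first exact: (X_add qX).
apply: le_trans (KX (Xv m) Xt) _.
have -> : 2 * K * q ^+ m * G = K * (q ^+ m * G + 2 * K * q ^+ m.+1 * G).
  by rewrite exprS [2 * K * (q * _)]mulrA qK; ring.
by apply: ler_wpM2l; [exact: ltW|exact: lerD].
Qed.

Let Xu n : X (u n).
Proof. by have [] := tail n 0. Qed.

Let nu n : nX (u n) <= 2 * K * G.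
Proof. by have [_] := tail n 0; rewrite expr0 mulr1. Qed.

Let u_diff m n : (m <= n)%N -> u n \- u m = fun x => \sum_(i < n - m) v (m + i)%N x.
Proof.
move=> mn; have [j ->] : exists j, n = (m + j)%N by exists (n - m)%N; rewrite subnKC.
by apply/funext => x; rewrite /u /= addKn big_split_ord /= addrAC subrr add0r.
Qed.

Let q_small e : 0 < e -> exists N, forall m, (N <= m)%N -> 2 * K * q ^+ m * G < e.
Proof.
move=> e0; exists (Num.bound (2 * K * G / e)); set N := Num.bound _ => m Nm.
have q2 : q <= 2^-1 by rewrite lef_pV2 ?posrE ?mulr_gt0//; move: K_ge1; lra.
have KG : 0 <= 2 * K * G by rewrite !mulr_ge0// ltW.
have h : 2 * K * G / e < 2 ^+ m.
  apply: lt_le_trans (archi_boundP _) _; first by rewrite divr_ge0// ltW.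
  by rewrite -natrX ler_nat (leq_trans Nm)// ltnW// ltn_expl.
have qm : q ^+ m <= 2^-1 ^+ m by rewrite lerXn2r ?nnegrE// ltW.
rewrite mulrAC; apply: (@le_lt_trans _ _ (2 * K * G * 2^-1 ^+ m)).
  by rewrite ler_wpM2l.
by rewrite exprVn ltr_pdivrMr ?exprn_gt0// [e * _]mulrC -ltr_pdivrMr.
Qed.

Let u_cauchy e : 0 < e -> exists N, forall m n, (N <= m)%N -> (N <= n)%N ->
  nX (u n \- u m) < e.
Proof.
move=> /q_small[N hN]; exists N.
have le_case m n : (N <= m)%N -> (m <= n)%N -> nX (u n \- u m) < e.
  move=> Nm mn; rewrite u_diff//; apply: le_lt_trans (hN m Nm).
  by have [] := tail (n - m) m.
move=> m n Nm Nn; have [mn|/ltnW nm] := leqP m n; first exact: le_case.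
have [_ <-] := X_opp (X_sub (Xu n) (Xu m)).
rewrite (_ : \- _ = u m \- u n); first exact: le_case.
by apply/funext => x /=; rewrite opprB.
Qed.

Let W x := (\sum_(n <oo) (v n x)%:E)%E.

Let W_ge0 x : (0 <= W x)%E.
Proof. by apply: nneseries_ge0 => n _ _; rewrite lee_fin. Qed.

Let measurable_W : measurable_fun setT W.
Proof.
apply: (@ge0_emeasurable_sum _ _ _ setT (fun n x => (v n x)%:E) xpredT).
  by move=> n x _ _; rewrite lee_fin.
by move=> n _; apply/measurable_EFinP; exact: X_measurable qX _ (Xv n).
Qed.

(* No Fatou property is available: the pointwise sum is controlled by the
   norm limit h, since (u m - h)^+ <= |u n - h| for every n >= m. *)
Lemma X_series : [/\ {ae mu, forall x, (W x < +oo)%E}, X (fun x => fine (W x)) &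
  nX (fun x => fine (W x)) <= 2 * K ^+ 2 * G].
Proof.
have [h Xh hlim] := X_complete qX Xu u_cauchy.
have uh m : {ae mu, forall x, u m x <= h x}.
  pose p x := Num.max (u m x - h x) 0.
  have p_ge0 x : 0 <= p x by rewrite le_max lexx orbT.
  have mp : measurable_fun setT p.
    apply: (@measurable_maxr _ _ _ setT (u m \- h) (cst 0)) => //.
    exact: X_measurable qX _ (X_sub (Xu m) Xh).
  have pn n : (m <= n)%N -> X p /\ nX p <= nX (u n \- h).
    move=> mn; apply: (X_ideal qX) (X_sub (Xu n) Xh) mp _; apply: aeW => x.
    rewrite ger0_norm//= ge_max normr_ge0 andbT.
    apply: le_trans (ler_norm _); rewrite lerB//.
    have := congr1 (@^~ x) (u_diff mn) => /=.
    have : 0 <= \sum_(i < n - m) v (m + i)%N x by apply: sumr_ge0.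
    by move=> s0 es; rewrite -subr_ge0 es.
  have [Xp _] := pn m (leqnn m).
  have p0 : nX p = 0.
    apply/eqP; rewrite eq_le (nX_ge0 qX Xp) andbT; apply/ler_addgt0Pr => e e0.
    rewrite add0r; have [N hN] := hlim e e0.
    have [_ /le_trans] := pn (maxn m N) (leq_maxl _ _); apply.
    by apply/ltW/hN; exact: leq_maxr.
  have /(nX_eq0 qX Xp) := p0; apply: filterS => x px.
  by rewrite -subr_le0 -px le_max lexx.
have Wh : {ae mu, forall x, (W x <= (h x)%:E)%E}.
  apply: filterS (ae_foralln uh) => x ux.
  apply: lime_le; first by apply: is_cvg_nneseries => n _ _; rewrite lee_fin.
  by apply: nearW => n; rewrite sumEFin lee_fin big_mkord; exact: ux.
have nh : nX h <= 2 * K ^+ 2 * G.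
  apply/ler_addgt0Pr => e e0.
  have [N /(_ N (leqnn N)) hN] := hlim (e / K) (divr_gt0 e0 K_gt0).
  have [Xd nd] := X_opp (X_sub (Xu N) Xh).
  (* Passing to the limit costs one more quasi-triangle inequality, whence the square of [K]. *)
  have -> : h = (\- (u N \- h)) \+ u N by apply/funext => x /=; rewrite opprB subrK.
  apply: le_trans (KX Xd (Xu N)) _; rewrite nd.
  have -> : 2 * K ^+ 2 * G + e = K * (e / K + 2 * K * G).
    by field; rewrite gt_eqF.
  by apply: ler_wpM2l; [exact: ltW|apply: lerD => //; exact: ltW].
have [Xw nw] : X (fun x => fine (W x)) /\ nX (fun x => fine (W x)) <= nX h.
  apply: (X_ideal qX Xh).
    exact: measurableT_comp measurable_W.
  apply: filterS Wh => x Wx; rewrite ger0_norm ?fine_ge0//.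
  apply: le_trans (ler_norm _); rewrite -lee_fin fineK//.
  by rewrite ge0_fin_numE// (le_lt_trans Wx)// ltry.
split => //; last exact: le_trans nw nh.
by apply: filterS Wh => x /le_lt_trans; apply; exact: ltry.
Qed.

End Series.

Lemma rubio_de_francia : exists2 C : R, 0 < C & forall g, X g -> exists w,
  [/\ X w, forall x, 0 <= w x, {ae mu, forall x, `|g x| <= w x},
      nX w <= 2 * K ^+ 2 * nX g &
      forall Q, is_cube Q -> {ae mu, forall y, cube_set Q y -> av w Q <= C * w y}].
Proof.
have [C1 C1_gt0 maj] := X_majorant d_gt0 qX K_ge1 KX spX.
(* Dividing the [n]-th iterate by [C ^+ n] leaves the decay [(2 * K)^-1 ^+ n] that [X_series]
   requires. *)
pose C := 2 * K * C1; have C_gt0 : 0 < C by rewrite !mulr_gt0.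
exists C => // g Xg.
(* The majorants are chosen arbitrarily, with no sublinearity; below only the averages are summed,
   and these are additive on nonnegative functions. *)
have /choice[Maj hMaj] : forall f, exists F, X f -> [/\ X F, forall x, 0 <= F x,
    nX F <= C1 * nX f & forall Q, is_cube Q ->
      {ae mu, forall y, cube_set Q y -> av f Q <= F y}].
  move=> f; have [/maj[F hF]|nXf] := pselect (X f); first by exists F.
  by exists f.
pose f n := iter n Maj (fun x => `|g x|).
have [Xg' ng'] : X (fun x => `|g x|) /\ nX (fun x => `|g x|) <= nX g.
  apply: (X_ideal qX Xg); last by apply: aeW => x; rewrite normr_id.
  by apply: measurableT_comp => //; exact: X_measurable qX _ Xg.
have Xf n : X (f n) by elim: n => [//|n IH]; have [] := hMaj _ IH.
have f_ge0 n x : 0 <= f n x.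
  by case: n => [//=|n]; have [_ + _ _] := hMaj _ (Xf n); apply.
have nf n : nX (f n) <= C1 ^+ n * nX g.
  elim: n => [|n IH]; first by rewrite mul1r.
  have [_ _ h _] := hMaj _ (Xf n); apply: (le_trans h).
  by rewrite exprS -mulrA ler_wpM2l// ltW.
pose v n x := C^-1 ^+ n * f n x.
have Ci_ge0 n : 0 <= C^-1 ^+ n by rewrite exprn_ge0// invr_ge0 ltW.
have Xv n : X (v n) by exact: (X_scale qX).
have v_ge0 n x : 0 <= v n x by rewrite mulr_ge0.
have nv n : nX (v n) <= (2 * K)^-1 ^+ n * nX g.
  rewrite (nX_scale qX)// ger0_norm//.
  have -> : (2 * K)^-1 ^+ n * nX g = C^-1 ^+ n * (C1 ^+ n * nX g).
    have -> : (2 * K)^-1 = C^-1 * C1 by rewrite /C [in RHS]invfM mulfVK// gt_eqF.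
    by rewrite exprMn mulrA.
  by rewrite ler_wpM2l.
have [Wfin Xw nw] := X_series (nX_ge0 qX Xg) Xv v_ge0 nv.
set W := fun x => (\sum_(n <oo) (v n x)%:E)%E in Wfin Xw nw.
have W_ge0 x : (0 <= W x)%E by apply: nneseries_ge0 => n _ _; rewrite lee_fin.
have w_ge0 x : 0 <= fine (W x) by apply: fine_ge0.
have WE x : (W x < +oo)%E -> W x = (fine (W x))%:E.
  by move=> Wx; rewrite fineK// ge0_fin_numE.
exists (fun x => fine (W x)); split => //.
- apply: filterS Wfin => x Wx; rewrite -lee_fin -WE//.
  have -> : `|g x|%:E = (\sum_(0 <= n < 1) (v n x)%:E)%E.
    by rewrite big_nat1 /v expr0 mul1r.
  by apply: nneseries_lim_ge => n _; rewrite lee_fin.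
move=> Q Q0; set w := fun x => fine (W x).
have lw : locint w by exact: X_locint qX spX _ Xw.
have mQ := measurable_cube Q.
have s0 : 0 < side Q ^+ d by rewrite exprn_gt0.
have mE (h : T -> R) : measurable_fun setT h ->
    measurable_fun (cube_set Q) (fun x => (h x)%:E).
  by move=> mh; apply: measurable_funTS; exact/measurable_EFinP.
have intw : (\int[mu]_(x in cube_set Q) (`|w x|)%:E <=
    \sum_(n <oo) (C^-1 ^+ n * (av (f n) Q * side Q ^+ d))%:E)%E.
  have -> : (\sum_(n <oo) (C^-1 ^+ n * (av (f n) Q * side Q ^+ d))%:E =
      \int[mu]_(x in cube_set Q) W x)%E.
    rewrite integral_nneseries//; last 2 first.
    - by move=> n; apply: mE; exact: X_measurable qX _ (Xv n).
    - by move=> n x _; rewrite lee_fin.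
    apply: eq_eseriesr => n _; rewrite EFinM.
    rewrite -integral_av//; last exact: X_locint qX spX _ (Xf n).
    rewrite -ge0_integralZl_EFin//; last first.
      by apply: measurable_funTS; apply: measurable_absE; exact: X_measurable qX _ (Xf n).
    by apply: eq_integral => x _; rewrite -EFinM ger0_norm.
  apply: ae_ge0_le_integral => //.
  - by apply: measurable_funTS; apply: measurable_absE; case: lw.
  - apply: measurable_funTS.
    apply: (@ge0_emeasurable_sum _ _ _ setT (fun n x => (v n x)%:E) xpredT).
      by move=> n x _ _; rewrite lee_fin.
    by move=> n _; apply/measurable_EFinP; exact: X_measurable qX _ (Xv n).
  apply: filterS Wfin => x Wx _.
  by rewrite /w ger0_norm// -WE.
have majf : {ae mu, forall y, forall n, cube_set Q y -> av (f n) Q <= f n.+1 y}.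
  by apply: ae_foralln => n; have [_ _ _] := hMaj _ (Xf n); apply.
apply: filterS2 majf Wfin => y fy Wy Qy.
rewrite -(ler_pM2r s0) -lee_fin -integral_av//; apply: (le_trans intw).
(* Averaging the [n]-th iterate leads to the next one, so the series shifts by one index: this gives
   the factor [C] and drops only [v 0], which is nonnegative. *)
apply: (@le_trans _ _ (\sum_(n <oo) (C * side Q ^+ d)%:E * (v n.+1 y)%:E)%E).
  apply: lee_nneseries => [n _ _|n _].
    by rewrite lee_fin !mulr_ge0 ?av_ge0// ltW.
  rewrite -EFinM lee_fin /v.
  have -> : C * side Q ^+ d * (C^-1 ^+ n.+1 * f n.+1 y) =
      C^-1 ^+ n * (f n.+1 y * side Q ^+ d).
    by rewrite exprS; field; rewrite gt_eqF.
  by rewrite ler_wpM2l// ler_wpM2r ?(ltW s0)// fy.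
rewrite nneseriesZl; last by move=> n _; rewrite lee_fin.
rewrite [X in (_ <= X%:E)%E]mulrAC [leRHS]EFinM /w -WE//.
apply: lee_wpmul2l; first by rewrite lee_fin mulr_ge0// ltW.
rewrite (_ : (\sum_(n <oo) _)%E = (\sum_(1 <= n <oo) (v n y)%:E)%E); last first.
  rewrite -(@nneseries_addn _ (fun n => (v n y)%:E) 1)//.
    by apply: eq_eseriesr => n _; rewrite addn1.
  by move=> n; rewrite lee_fin.
rewrite [leRHS](nneseries_split 0 1)//; last by move=> n _; rewrite lee_fin.
by rewrite leeDr// sume_ge0// => n _; rewrite lee_fin.
Qed.

End RubioDeFrancia.

(** * Measurability of sparse operators *)

Section SparseCountable.
Variable R : realType.
Variable d : nat.
Local Notation T := (Rd R d).
Local Notation mu := (leb R d).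

Let box (N : nat) : cube R d := Cube (fun=> - N.+1%:R) (2 * N.+1%:R).

Let is_cube_box N : is_cube (box N).
Proof. by rewrite /is_cube /= mulr_gt0. Qed.

Let box_cover (x : T) : exists N, cube_set (box N) x.
Proof.
exists (\sum_(i < d) Num.bound `|coord x i|)%N => i /=.
set N := (\sum_(i < d) _)%N.
have : `|coord x i| < N.+1%:R.
  apply: lt_le_trans (archi_boundP (normr_ge0 _)) _.
  by rewrite ler_nat leqW// /N (bigD1 i)//= leq_addr.
by rewrite ltr_norml => /andP[h1 h2]; apply/andP; split; lra.
Qed.

HB.instance Definition _ := isPointed.Build (cube R d) (Cube (fun=> 0) 0).

(** The parts [E Q] are disjoint of positive measure, and a box of finite measure has room for
    finitely many whose trace on it has measure at least [1 / (j + 1)]. *)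
Lemma sparse_countable (S : set (cube R d)) : sparse S -> countable S.
Proof.
move=> [Sc [E [ES Edis]]].
have mES Q N : S Q -> measurable (E Q `&` cube_set (box N)).
  by move=> /ES[mE _]; apply: measurableI => //; exact: measurable_cube.
pose F (p : nat * nat) := [set Q | S Q /\
  ((p.2.+1%:R^-1)%:E <= mu (E Q `&` cube_set (box p.1)))%E].
have SF : S `<=` \bigcup_(p in setT) F p.
  move=> Q SQ; have [mE [_ EQ]] := ES Q SQ.
  have E0 : (0 < mu (E Q))%E.
    by apply: lt_le_trans EQ; rewrite mule_gt0// leb_cube_gt0//; exact: Sc.
  have [N N0] : exists N, (0 < mu (E Q `&` cube_set (box N)))%E.
    apply: contrapT => /forallNP nN.
    have : mu.-negligible (E Q).
      apply: (@negligibleS _ _ _ mu (\bigcup_N (E Q `&` cube_set (box N)))).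
        by move=> x Ex; have [N Nx] := box_cover x; exists N.
      apply: negligible_bigcup => N; exists (E Q `&` cube_set (box N)); split => //.
        exact: mES.
      by apply/eqP; rewrite -measure_le0 leNgt; apply/negP/nN.
    by move=> /(measure_negligible mE) h; move: E0; rewrite h ltxx.
  have Nfin : mu (E Q `&` cube_set (box N)) \is a fin_num.
    rewrite ge0_fin_numE//; apply: le_lt_trans (leb_cube_lty (is_cube_box N)).
    by apply: measureIr => //; exact: measurable_cube.
  set e := mu (E Q `&` _) in N0 Nfin.
  have e0 : 0 < fine e by rewrite fine_gt0// N0 -ge0_fin_numE ?ltW.
  exists (N, Num.bound (fine e)^-1) => //; split => //=.
  rewrite -/e -(fineK Nfin) lee_fin -[leRHS]invrK lef_pV2 ?posrE ?invr_gt0//.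
  apply: ltW; apply: lt_le_trans (archi_boundP _) _; first by rewrite invr_ge0 ltW.
  by rewrite ler_nat.
apply: (sub_countable (subset_card_le SF)).
apply: bigcup_countable => // -[N j] _; apply: finite_set_countable.
apply: contrapT => infF.
have Bfin : mu (cube_set (box N)) \is a fin_num.
  by rewrite ge0_fin_numE// leb_cube_lty.
pose b := fine (mu (cube_set (box N))).
have /infiniteP/pcard_leP[q] := infF.
have qF n : F (N, j) (q n) by exact: funS.
pose A n := E (q n) `&` cube_set (box N).
have mA n : measurable (A n) by have [SQ _] := qF n; exact: mES.
have tA : trivIset setT A.
  move=> m n _ _ [x [[Em _] [En _]]]; apply: contrapT => mn.
  have [Sm _] := qF m; have [Sn _] := qF n.
  have qmn : q m <> q n by move=> /(inj (mem_setT _) (mem_setT _)).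
  by have /seteqP[/(_ x) h _] := Edis _ _ Sm Sn qmn; exact: h.
have Ab n : (\sum_(0 <= i < n) mu (A i) <= b%:E)%E.
  apply: (@le_trans _ _ (\sum_(i <oo) mu (A i))%E).
    by apply: nneseries_lim_ge.
  rewrite -measure_semi_bigcup//; last exact: bigcupT_measurable.
  rewrite /b fineK//; apply: le_measure; rewrite ?inE.
  - exact: bigcupT_measurable.
  - exact: measurable_cube.
  - by move=> x [n' _ []].
have An n : ((n%:R * j.+1%:R^-1)%:E <= \sum_(0 <= i < n) mu (A i))%E.
  elim: n => [|n IH]; first by rewrite mul0r big_nil.
  rewrite big_nat_recr//= -natr1 mulrDl mul1r EFinD leeD//.
  by have [] := qF n.
have := le_trans (An (Num.bound (j.+1%:R * b))) (Ab _).
rewrite lee_fin ler_pdivrMr// mulrC leNgt => /negP; apply.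
by apply: archi_boundP; rewrite mulr_ge0// fine_ge0.
Qed.

(** Countability turns the unordered sum into a series. The ideal property applies only to
    measurable functions, so this is needed before [A_S f] can be compared with [A_S w]. *)
Lemma measurable_sparse_op (S : set (cube R d)) (f : T -> R) : sparse S ->
  measurable_fun setT (sparse_op S f).
Proof.
move=> spS; have [Sc _] := spS.
have t_ge0 Q x : S Q -> (0 <= avg Q f * (\1_(cube_set Q) x)%:E)%E.
  by move=> SQ; rewrite mule_ge0 ?avg_ge0//; exact: Sc.
have /countable_bijP[B] := sparse_countable spS.
rewrite card_eq_sym => /card_set_bijP[e eB].
pose a n x := (avg (e n) f * (\1_(cube_set (e n)) x)%:E)%E.
have Be n : B n -> S (e n) by case: eB => + _ _; apply.
rewrite (_ : sparse_op S f = fun x => (\sum_(n <oo | n \in B) a n x)%E).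
  apply: (@ge0_emeasurable_sum _ _ _ setT a (mem B)).
    by move=> n x _; rewrite inE => /Be; exact: t_ge0.
  move=> n _; apply: emeasurable_funM => //.
  apply/measurable_EFinP; apply: measurable_indic; exact: measurable_cube.
apply/funext => x; rewrite nneseries_esum; last first.
  by move=> n; rewrite inE => /Be; exact: t_ge0.
rewrite /sparse_op (reindex_esum B S e _ eB).
by rewrite (_ : [set x0 | x0 \in B] = B)//; apply/seteqP; split => n /=; rewrite inE.
Qed.

End SparseCountable.

(** Write [x^r = x * x^(r - 1)] and enlarge the second factor to [(x + y)^(r - 1)]. *)
Lemma powR_superadd (R : realType) (x y r : R) : 1 <= r -> 0 <= x -> 0 <= y ->
  x `^ r + y `^ r <= (x + y) `^ r.
Proof.
move=> r1 x0 y0; have r0 : 0 < r by exact: lt_le_trans r1.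
have xy0 : 0 <= x + y by rewrite addr_ge0.
rewrite -(mulr_powRB1 x0 r0) -(mulr_powRB1 y0 r0) -(mulr_powRB1 xy0 r0) mulrDl.
by apply: lerD; apply: ler_wpM2l => //; apply: ge0_ler_powR;
  rewrite ?nnegrE ?subr_ge0 ?lerDl ?lerDr.
Qed.

Lemma sum_powR_le (R : realType) (I : Type) (s : seq I) (a : I -> R) (r : R) :
  1 <= r -> (forall i, 0 <= a i) ->
  \sum_(i <- s) a i `^ r <= (\sum_(i <- s) a i) `^ r.
Proof.
move=> r1 a0; elim: s => [|i s IH].
  by rewrite !big_nil powR0// gt_eqF// (lt_le_trans _ r1).
rewrite !big_cons; apply: le_trans (powR_superadd r1 (a0 i) _).
  by rewrite lerD2l.
by apply: sumr_ge0.
Qed.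

(** * Powers *)

Section Powers.
Variable R : realType.
Variable d : nat.
Local Notation T := (Rd R d).
Local Notation mu := (leb R d).

(** The [l^r] norm is at most the [l^1] norm for [r >= 1], applied to the finite subsums whose
    supremum is the sparse operator. *)
Lemma sparse_op_pow_le (S : set (cube R d)) (f w : T -> R) (c r : R) (x : T) :
  sparse S -> locint w -> 0 <= c -> 1 <= r ->
  (forall Q, S Q -> (avg Q f <= (c * av w Q `^ r)%:E)%E) ->
  (sparse_op S w x < +oo)%E ->
  (sparse_op S f x <= (c * fine (sparse_op S w x) `^ r)%:E)%E.
Proof.
move=> spS lw c0 r1 fw wfin; have [Sc _] := spS.
have w_ge0 := sparse_op_ge0 w x spS.
have r0 : r != 0 by rewrite gt_eqF// (lt_le_trans _ r1).
(* The absolute value makes [a] nonnegative for every [Q], also outside [S], as [sum_powR_le]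
   requires. *)
pose a Q : R := `|av w Q| * \1_(cube_set Q) x.
have a_ge0 Q : 0 <= a Q by rewrite mulr_ge0.
have aE Q : S Q -> (avg Q w * (\1_(cube_set Q) x)%:E = (a Q)%:E)%E.
  move=> SQ; have Q0 := Sc _ SQ.
  by rewrite /a ger0_norm ?av_ge0// avE// -EFinM.
apply: ge_ereal_sup => _ [A [finA AS] <-].
apply: (@le_trans _ _ (\sum_(Q \in A) (c * a Q `^ r)%:E)%E).
  apply: lee_fsum => // Q /AS SQ.
  rewrite /a indicE; case: (x \in cube_set Q) => /=.
    by rewrite mule1 mulr1 ger0_norm ?av_ge0//; [exact: fw|exact: Sc].
  by rewrite mule0 mulr0 powR0// mulr0.
rewrite fsbig_finite//= sumEFin lee_fin -mulr_sumr ler_wpM2l//.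
apply: le_trans (sum_powR_le _ r1 a_ge0) _.
apply: ge0_ler_powR; rewrite ?nnegrE ?fine_ge0 ?sumr_ge0//; first by lra.
rewrite -lee_fin fineK ?ge0_fin_numE// -sumEFin.
rewrite -(@fsbig_finite _ _ _ _ _ (fun Q => (a Q)%:E) finA).
apply: esum_ge; exists A => //.
by apply: lee_fsum => // Q /AS SQ; rewrite aE.
Qed.

Hypothesis d_gt0 : (0 < d)%N.
Variables (X : set (T -> R)) (nX : (T -> R) -> R) (K : R).
Hypothesis qX : qBFS X nX.
Hypothesis K_ge1 : 1 <= K.
Hypothesis KX : quasi_triangle X nX K.

(** [r0] comes from one admissible constant, while the bound holds for every admissible [C0]. This
    order of quantifiers permits an infimum over [C0] with [r] fixed. *)
Lemma Asparse_pow : Asparse X nX -> exists2 r0 : R, 1 < r0 &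
  forall r, 1 < r -> r <= r0 -> forall C0, Asparse_with X nX C0 ->
    Asparse_with (Xpow X r) (nXpow nX r) ((16 * K ^+ 2 * C0) `^ r).
Proof.
move=> [C' spX']; have [C C_gt0 rubio] := rubio_de_francia d_gt0 qX K_ge1 KX spX'.
(* The largest [delta] with [2^d * delta * C <= 1 / 2], the smallness condition of
   [reverse_holder]. *)
pose e := (2 * (2 ^+ d * C))^-1.
have e_gt0 : 0 < e by rewrite invr_gt0 !mulr_gt0// exprn_gt0.
exists (1 + Num.min 1 e); first by rewrite ltrDl lt_min ltr01.
move=> r r1 rr0 C0 spX; split; first exact: powR_ge0.
have r_gt0 : 0 < r by exact: lt_trans r1.
have ri_gt0 : 0 < r^-1 by rewrite invr_gt0.
have r_ge1 : 1 <= r by exact: ltW.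
have C0_ge0 : 0 <= C0 by case: spX.
move=> S f spS [mf Xg]; set g := fun x => _ in Xg.
have gE x : `|f x| = g x `^ r by rewrite /g -powRrM mulVf ?gt_eqF// powRr1.
have [w [Xw w_ge0 gw nw A1]] := rubio g Xg.
have lw := X_locint qX spX Xw.
have [Sc _] := spS.
have avf Q : S Q -> (avg Q f <= (8 * av w Q `^ r)%:E)%E.
  move=> SQ; have Q0 := Sc _ SQ; have s0 : 0 < side Q ^+ d by rewrite exprn_gt0.
  have rE : 1 + (r - 1) = r by rewrite subrKC.
  have := @reverse_holder R d w C (r - 1) Q lw w_ge0 (ltW C_gt0) A1.
  rewrite rE => rh.
  have {}rh : (\int[mu]_(y in cube_set Q) (w y `^ r)%:E <=
      (8 * av w Q `^ r * side Q ^+ d)%:E)%E.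
    move: rr0; rewrite -lerBlDl le_min => /andP[rm1 rme].
    apply: rh => //; first by rewrite subr_gt0 r1.
    rewrite mulrAC mulrC; apply: le_trans (ler_wpM2r _ rme) _.
      by rewrite mulr_ge0 ?exprn_ge0// ltW.
    rewrite /e invfM -mulrA mulVf ?mulr1//.
    by rewrite gt_eqF// mulr_gt0// exprn_gt0.
  have intf : (\int[mu]_(y in cube_set Q) (`|f y|)%:E <=
      \int[mu]_(y in cube_set Q) (w y `^ r)%:E)%E.
    apply: ae_ge0_le_integral => //.
    - exact: measurable_cube.
    - by apply: measurable_funTS; exact: measurable_absE.
    - by move=> y _; rewrite lee_fin powR_ge0.
    - apply: measurable_funTS; apply/measurable_EFinP.
      exact: measurableT_comp (measurable_powR _) lw.1.
    apply: filterS gw => y gwy _; rewrite lee_fin gE; apply: ge0_ler_powR.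
    - exact: ltW.
    - by rewrite nnegrE powR_ge0.
    - by rewrite nnegrE.
    - exact: le_trans (ler_norm _) gwy.
  have := le_trans intf rh; rewrite integral_avg//.
  rewrite EFinM lee_pmul2r ?fin_numE//.
have [Xop nop] := X_sparse_op spX Xw spS.
have f_ge0 x := sparse_op_ge0 f x spS.
have bound : {ae mu, forall x, (sparse_op S f x <=
    (8 * fine (sparse_op S w x) `^ r)%:E)%E}.
  by apply: filterS (X_sparse_fin spX Xw spS) => x; exact: sparse_op_pow_le.
have mop : measurable_fun setT (fun x => fine (sparse_op S f x)).
  by apply: measurableT_comp => //; exact: measurable_sparse_op.
have [Xf nf] : X (fun x => `|fine (sparse_op S f x)| `^ r^-1) /\
    nX (fun x => `|fine (sparse_op S f x)| `^ r^-1) <=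
    nX (fun x => 8 * fine (sparse_op S w x)).
  apply: (X_ideal qX (X_scale qX 8 Xop)).
    apply: measurableT_comp (measurable_powR _) _.
    by apply: measurableT_comp.
  apply: filterS bound => x bx.
  rewrite !ger0_norm ?powR_ge0 ?mulr_ge0 ?fine_ge0 ?sparse_op_ge0//.
  have w0 : 0 <= fine (sparse_op S w x) by rewrite fine_ge0// sparse_op_ge0.
  (* Since [r >= 1], the 8 moves inside the power; after the [r]-th root it is a constant
     independent of [r], and with the [2 * K ^+ 2] of the weight it makes 16. *)
  have f8 : fine (sparse_op S f x) <= (8 * fine (sparse_op S w x)) `^ r.
    rewrite -lee_fin fineK; last first.
      by rewrite ge0_fin_numE// (le_lt_trans bx)// ltry.
    apply: (le_trans bx); rewrite lee_fin powRM// ler_wpM2r ?powR_ge0//.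
    by apply: le1r_powR => //; rewrite ler1n.
  have := @ge0_ler_powR R r^-1 (ltW ri_gt0) _ _ _ _ f8.
  rewrite -powRrM divff ?gt_eqF// powRr1 ?mulr_ge0//; apply.
  - by rewrite nnegrE fine_ge0.
  - by rewrite nnegrE powR_ge0.
split; first by apply: filterS bound => x /le_lt_trans; apply; exact: ltry.
split; first by split.
have B0 : 0 <= 16 * K ^+ 2 * C0.
  by apply: mulr_ge0 => //; apply: mulr_ge0 => //; exact: sqr_ge0.
have g0 := nX_ge0 qX Xg.
rewrite /nXpow -(powRM _ B0 g0).
apply: ge0_ler_powR; first exact: ltW.
- by rewrite nnegrE; exact: nX_ge0 qX _ Xf.
- by rewrite nnegrE; exact: mulr_ge0.
apply: (le_trans nf); rewrite (nX_scale qX)// ger0_norm//.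
have : C0 * nX w <= C0 * (2 * K ^+ 2 * nX g) by rewrite ler_wpM2l.
by move: nop; rewrite -/g; lra.
Qed.

End Powers.

Theorem theorem3p13 (R : realType) (d : nat) (K : R) : (0 < d)%N ->
  exists2 c : R, 0 < c &
  forall (X : set (Rd R d -> R)) (nX : (Rd R d -> R) -> R),
    qBFS X nX -> optimal_const X nX K -> Asparse X nX ->
    exists2 r0 : R, 1 < r0 &
      forall r : R, 1 < r -> r <= r0 ->
        Asparse (Xpow X r) (nXpow nX r) /\
        powR (Asparse_const (Xpow X r) (nXpow nX r)) r^-1
          <= c * Asparse_const X nX.
Proof.
(* The constant is fixed before [1 <= K] is known; the added 1 makes it positive for every real
   [K]. *)
move=> d0; exists (16 * (1 + K ^+ 2)).
  by rewrite mulr_gt0// ltr_wpDr// sqr_ge0.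
move=> X nX qX [K1 [KX _]] spX.
have [r0 r01 pow] := Asparse_pow d0 qX K1 KX spX.
exists r0 => // r r1 rr0; have [C HC] := spX.
have r_gt0 : 0 < r by exact: lt_trans r1.
split; first by exists ((16 * K ^+ 2 * C) `^ r); exact: pow.
set L := powR _ _.
have lb (Y : set (Rd R d -> R)) nY : has_lbound [set C | Asparse_with Y nY C].
  by exists 0 => C' [].
have LC C' : Asparse_with X nX C' -> L <= 16 * (1 + K ^+ 2) * C'.
  move=> HC'; have C'0 : 0 <= C' by case: HC'.
  have KC : 0 <= 16 * K ^+ 2 * C'.
    by apply: mulr_ge0 => //; apply: mulr_ge0 => //; exact: sqr_ge0.
  apply: (@le_trans _ _ (16 * K ^+ 2 * C')); last first.
    by rewrite ler_wpM2r// ler_wpM2l// lerDr.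
  have rn0 : r != 0 by rewrite gt_eqF.
  have -> : 16 * K ^+ 2 * C' = ((16 * K ^+ 2 * C') `^ r) `^ r^-1.
    by rewrite -powRrM divff// powRr1.
  apply: ge0_ler_powR; first by rewrite invr_ge0 ltW.
  - rewrite nnegrE; apply: lb_le_inf; last by move=> ? [].
    by exists ((16 * K ^+ 2 * C) `^ r); exact: pow.
  - by rewrite nnegrE powR_ge0.
  - by apply: ge_inf; [exact: lb|exact: pow].
have c0 : 0 < 16 * (1 + K ^+ 2) by rewrite mulr_gt0// ltr_wpDr// sqr_ge0.
(* After division by the constant, [L] is compared with each admissible [C'], so the infimum need
   not be attained. *)
rewrite -ler_pdivrMl//; apply: lb_le_inf; first by exists C.
by move=> C' /LC; rewrite -ler_pdivrMl.
Qed.
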